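(* Let $(G,G^+,u)$ be a simple dimension group with unit, and let $(p_n)_{n\in\mathbb{N}}$ be a sequence of positive real numbers such that $\lim_{n\to\infty} n/p_n=0$. Then there exists a minimal subshift $(Y,S)$ such that (1) $K^0(Y,S)$ and $(G,G^+,u)$ are isomorphic as ordered groups with unit; and (2) the complexity function $p_Y$ of $(Y,S)$ satisfies $\lim_{n\to\infty} p_Y(n)/p_n=0$.
   Context: $\mathbb{N}$ denotes the non-negative integers. Subshifts. An alphabet is a finite non-empty set $\mathcal{A}$; $\mathcal{A}^{\mathbb{Z}}$ carries the product topology of the discrete topologies, and $S((x_i)_{i\in\mathbb{Z}})=(x_{i+1})_{i\in\mathbb{Z}}$ is the shift. A subshift $(Y,S)$ is a closed shift-invariant subset $Y\subseteq\mathcal{A}^{\mathbb{Z}}$ together with the restriction of $S$. It is minimal if every $S$-orbit $\{S^k(y):k\in\mathbb{Z}\}$ is dense in $Y$. The complexity function $p_Y(n)$ is the number of distinct words of length $n$ occurring as blocks of consecutive letters in elements of $Y$. Ordered groups. An ordered group is a pair $(G,G^+)$ where $G$ is a countable abelian group and $G^+\subseteq G$ (the positive cone) satisfies $G^++G^+\subset G^+$, $G^+\cap(-G^+)=\{0\}$, $G^+-G^+=G$. Write $a\le b$ if $b-a\in G^+$. An order unit is $u\in G^+$ such that for each $a\in G$ there is a non-negative integer $k$ with $a\le ku$. Two ordered groups with unit $(G,G^+,u)$, $(H,H^+,v)$ are isomorphic if there is a group isomorphism $\varphi:G\to H$ with $\varphi(G^+)=H^+$ and $\varphi(u)=v$.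 Inductive limits. For homomorphisms $h_i:G_i\to G_{i+1}$, $i\in\mathbb{N}$, $\varinjlim_i(G_i,h_i)$ is the set of classes $[g,i]$ of pairs $(g,i)$, $g\in G_i$, where $(g,i)\sim(g',i')$ iff $h_k\circ\cdots\circ h_i(g)=h_k\circ\cdots\circ h_{i'}(g')$ for some $k\ge i,i'$, with its natural group structure. For $G_i=\mathbb{Z}^{d_i}$ and $h_i$ given by a matrix $A_i$ with non-negative integer entries, the induced order has positive cone consisting of the classes $[x,i]$ that have some representative $(x',i')$ with $x'$ having all coordinates non-negative. Dimension groups. An ordered group $(G,G^+)$ is a dimension group if it is isomorphic (as an ordered group) to an inductive limit $\mathbb{Z}^{d_0}\xrightarrow{A_0}\mathbb{Z}^{d_1}\xrightarrow{A_1}\mathbb{Z}^{d_2}\xrightarrow{A_2}\cdots$ with integers $d_i\ge 1$ and positive homomorphisms $A_i$ (given by non-negative integer matrices), endowed with the induced order. It is simple if all matrices $A_i$ can be chosen with strictly positive entries. A simple dimension group with unit is a triple $(G,G^+,u)$ with $(G,G^+)$ a simple dimension group and $u$ an order unit. Dynamical dimension group. For a dynamical system $(X,T)$ ($X$ compact metric, $T$ a homeomorphism), let $\beta f=f\circ T-f$. Then $K^0(X,T)=(H(X,T),H^+(X,T),[1])$ where $H(X,T)=C(X,\mathbb{Z})/\beta C(X,\mathbb{Z})$, $H^+(X,T)$ is the set of classes of non-negative functions, and $[1]$ is the class of the constant function $1$. *)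

(* Defs.v *)
From HB Require Import structures.
From mathcomp Require Import all_boot all_order all_algebra.
From mathcomp Require Import generic_quotient ring_quotient.
From mathcomp Require Import all_classical all_reals all_analysis.
From mathcomp Require Import zify ring.
Set Implicit Arguments.
Unset Strict Implicit.
Unset Printing Implicit Defensive.
Import Order.TTheory GRing.Theory Num.Theory.
Local Open Scope classical_set_scope.
Local Open Scope ring_scope.
Local Open Scope quotient_scope.

Record is_ordered_group (G : zmodType) (Gp : set G) : Prop := IsOrderedGroup {
  ordered_group_countable : countable [set: G];
  ordered_group_addr : forall a b, Gp a -> Gp b -> Gp (a + b);
  ordered_group_pointed : Gp `&` [set - a | a in Gp] = [set 0];
  ordered_group_generating : [set a - b | a in Gp & b in Gp] = [set: G]
}.

Definition is_order_unit (G : zmodType) (Gp : set G) (u : G) : Prop :=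
  Gp u /\ forall a, exists k : nat, Gp (u *+ k - a).

Definition ordered_group_iso (G H : zmodType) (Gp : set G) (Hp : set H) : Prop :=
  exists phi : {additive G -> H}, bijective phi /\ phi @` Gp = Hp.

Definition unital_ordered_group_iso (G H : zmodType) (Gp : set G) (Hp : set H)
    (u : G) (v : H) : Prop :=
  exists phi : {additive G -> H}, [/\ bijective phi, phi @` Gp = Hp & phi u = v].

Section InductiveLimit.
Variables (G : nat -> zmodType) (h : forall i, {additive G i -> G i.+1}).

(* The pair (g, i) is [Tagged G g]. *)
Definition ind_lim_pair := {i : nat & G i}.

HB.instance Definition _ := Choice.on ind_lim_pair.

Definition ind_lim_step (p : ind_lim_pair) : ind_lim_pair :=
  Tagged (fun i => G i) (h (tag p) (tagged p)).

(* As the level is part of a pair, equality of two iterates forces both to live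
   in the same group. *)
Definition ind_lim_equiv (p q : ind_lim_pair) : bool :=
  `[< exists m n : nat, iter m ind_lim_step p = iter n ind_lim_step q >].

Lemma ind_lim_equivP p q :
  reflect (exists m n : nat, iter m ind_lim_step p = iter n ind_lim_step q)
          (ind_lim_equiv p q).
Proof. exact: asboolP. Qed.

Lemma ind_lim_equiv_is_equiv : equiv_class_of ind_lim_equiv.
Proof.
split=> [p|p q|q p r].
- by apply/ind_lim_equivP; exists 0%N, 0%N.
- by apply/ind_lim_equivP/ind_lim_equivP => -[m [n e]]; exists n, m.
- move=> /ind_lim_equivP[m [n e]] /ind_lim_equivP[m' [n' e']]; apply/ind_lim_equivP.
  exists (m' + m)%N, (n + n')%N.
  by rewrite iterD e -iterD addnC iterD e' -iterD.
Qed.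

Canonical ind_lim_equiv_equiv := EquivRelPack ind_lim_equiv_is_equiv.
Canonical ind_lim_equiv_encModRel := defaultEncModRel ind_lim_equiv.

Definition ind_lim := {eq_quot ind_lim_equiv}.

HB.instance Definition _ := EqQuotient.on ind_lim.
HB.instance Definition _ := Choice.on ind_lim.

Definition ind_lim_class (i : nat) (g : G i) : ind_lim :=
  \pi_ind_lim (Tagged (fun i => G i) g : ind_lim_pair).

Lemma tag_iter_ind_lim_step n p : tag (iter n ind_lim_step p) = (n + tag p)%N.
Proof. by elim: n => //= n ->. Qed.

(* Junk unless [p] and [q] are at the same level. *)
Definition ind_lim_level_add (p q : ind_lim_pair) : ind_lim_pair :=
  Tagged (fun i => G i) (tagged p + tagged_as p q).

(* Both pairs are first pushed to the sum of their levels. *)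
Definition ind_lim_pair_add (p q : ind_lim_pair) : ind_lim_pair :=
  ind_lim_level_add (iter (tag q) ind_lim_step p) (iter (tag p) ind_lim_step q).

Definition ind_lim_pair_opp (p : ind_lim_pair) : ind_lim_pair :=
  Tagged (fun i => G i) (- tagged p).

Definition ind_lim_pair_zero : ind_lim_pair := Tagged (fun i => G i) (0 : G 0%N).

Lemma ind_lim_level_addE i (g g' : G i) :
  ind_lim_level_add (Tagged (fun i => G i) g) (Tagged (fun i => G i) g') =
  Tagged (fun i => G i) (g + g').
Proof. by rewrite /ind_lim_level_add tagged_asE. Qed.

Lemma ind_lim_pair_levelP p q : tag p = tag q ->
  exists i (g g' : G i),
    p = Tagged (fun i => G i) g /\ q = Tagged (fun i => G i) g'.
Proof. by case: p q => [i g] [j g'] /= e; subst j; exists i, g, g'. Qed.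

Lemma iter_ind_lim_level_add n p q : tag p = tag q ->
  iter n ind_lim_step (ind_lim_level_add p q) =
  ind_lim_level_add (iter n ind_lim_step p) (iter n ind_lim_step q).
Proof.
move=> epq; elim: n => //= n ->.
have [|i [g [g' [-> ->]]]] :=
    @ind_lim_pair_levelP (iter n ind_lim_step p) (iter n ind_lim_step q).
  by rewrite !tag_iter_ind_lim_step epq.
by rewrite ind_lim_level_addE /ind_lim_step /= ind_lim_level_addE raddfD.
Qed.

Lemma ind_lim_level_add_equiv p p' q q' : tag p = tag q -> tag p' = tag q' ->
  ind_lim_equiv p p' -> ind_lim_equiv q q' ->
  ind_lim_equiv (ind_lim_level_add p q) (ind_lim_level_add p' q').
Proof.
move=> epq epq' /ind_lim_equivP[m [m' em]] /ind_lim_equivP[n [n' en]].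
apply/ind_lim_equivP; exists (n + m)%N, (n + m')%N.
rewrite !iter_ind_lim_level_add // iterD em -iterD; congr ind_lim_level_add.
have := congr1 (@tag _ _) em; rewrite !tag_iter_ind_lim_step => tm.
have := congr1 (@tag _ _) en; rewrite !tag_iter_ind_lim_step => tn.
have enm : (m + n' = n + m')%N by lia.
by rewrite addnC iterD en -iterD enm.
Qed.

Lemma ind_lim_equiv_iter n p : ind_lim_equiv (iter n ind_lim_step p) p.
Proof. by apply/ind_lim_equivP; exists 0%N, n. Qed.

Lemma ind_lim_pi_iter n p : \pi_ind_lim (iter n ind_lim_step p) = \pi_ind_lim p.
Proof. by apply/eqmodP; exact: ind_lim_equiv_iter. Qed.

Lemma tag_lim_add p q :
  tag (iter (tag q) ind_lim_step p) = tag (iter (tag p) ind_lim_step q).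
Proof. by rewrite !tag_iter_ind_lim_step addnC. Qed.

Definition ind_lim_zero : ind_lim := lift_cst ind_lim ind_lim_pair_zero.
Definition ind_lim_add := lift_op2 ind_lim ind_lim_pair_add.
Definition ind_lim_opp := lift_op1 ind_lim ind_lim_pair_opp.

Canonical pi_lim_zero_morph := PiConst ind_lim_zero.

Lemma pi_lim_opp : {morph \pi_ind_lim : p / ind_lim_pair_opp p >-> ind_lim_opp p}.
Proof.
move=> p; unlock ind_lim_opp; apply/eqmodP.
have : ind_lim_equiv p (repr (\pi_ind_lim p)) by apply/eqmodP; rewrite reprK.
have io n q : iter n ind_lim_step (ind_lim_pair_opp q) =
    ind_lim_pair_opp (iter n ind_lim_step q).
  by elim: n => //= n ->; rewrite /ind_lim_step /ind_lim_pair_opp /= raddfN.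
move=> /ind_lim_equivP[m [n e]]; apply/ind_lim_equivP.
by exists m, n; rewrite !io e.
Qed.

Canonical pi_lim_opp_morph := PiMorph1 pi_lim_opp.

Lemma pi_lim_add : {morph \pi_ind_lim : p q / ind_lim_pair_add p q >-> ind_lim_add p q}.
Proof.
move=> p q; unlock ind_lim_add; apply/eqmodP.
apply: ind_lim_level_add_equiv; try exact: tag_lim_add.
  by apply/eqmodP; rewrite !ind_lim_pi_iter reprK.
by apply/eqmodP; rewrite !ind_lim_pi_iter reprK.
Qed.

Canonical pi_lim_add_morph := PiMorph2 pi_lim_add.

Lemma ind_lim_classP (x : ind_lim) : exists i (g : G i), x = ind_lim_class g.
Proof.
by elim/quotW: x => -[i g]; exists i, g.
Qed.

Lemma ind_lim_class_step i (g : G i) : ind_lim_class (h i g) = ind_lim_class g.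
Proof. exact: (ind_lim_pi_iter 1 (Tagged (fun i => G i) g)). Qed.

Lemma ind_lim_class_lift i n (g : G i) :
  exists g' : G (n + i)%N, ind_lim_class g = ind_lim_class g'.
Proof.
elim: n => [|n [g' ->]]; first by exists g.
by exists (h _ g'); rewrite ind_lim_class_step.
Qed.

Lemma ind_lim_class_addE i (g g' : G i) :
  ind_lim_add (ind_lim_class g) (ind_lim_class g') = ind_lim_class (g + g').
Proof.
rewrite /ind_lim_class -pi_lim_add /ind_lim_pair_add /= -iter_ind_lim_level_add //.
by rewrite ind_lim_pi_iter ind_lim_level_addE.
Qed.

Lemma ind_lim_common2 (x y : ind_lim) :
  exists i (g g' : G i), x = ind_lim_class g /\ y = ind_lim_class g'.
Proof.
have [i [g ->]] := ind_lim_classP x; have [j [g' ->]] := ind_lim_classP y.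
have [a ->] := ind_lim_class_lift j g; have [b ->] := ind_lim_class_lift i g'.
by move: a b; rewrite addnC => a b; exists (i + j)%N, a, b.
Qed.

Lemma ind_lim_common3 (x y z : ind_lim) : exists i (g g' g'' : G i),
  [/\ x = ind_lim_class g, y = ind_lim_class g' & z = ind_lim_class g''].
Proof.
have [i [g [g' [-> ->]]]] := ind_lim_common2 x y; have [j [g'' ->]] := ind_lim_classP z.
have [a ->] := ind_lim_class_lift j g; have [b ->] := ind_lim_class_lift j g'.
have [c ->] := ind_lim_class_lift i g''.
by move: a b c; rewrite addnC => a b c; exists (i + j)%N, a, b, c.
Qed.

Lemma ind_lim_zeroE i : ind_lim_zero = ind_lim_class (0 : G i).
Proof.
rewrite piE -/(ind_lim_class (0 : G 0%N)).
by elim: i => // i ->; rewrite -[RHS]/(ind_lim_class _) -(ind_lim_class_step 0) raddf0.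
Qed.

Lemma ind_lim_oppE i (g : G i) : ind_lim_opp (ind_lim_class g) = ind_lim_class (- g).
Proof. by rewrite /ind_lim_class -pi_lim_opp. Qed.

Lemma ind_lim_addA : associative ind_lim_add.
Proof.
move=> x y z; have [i [a [b [c [-> -> ->]]]]] := ind_lim_common3 x y z.
by rewrite !ind_lim_class_addE addrA.
Qed.

Lemma ind_lim_addC : commutative ind_lim_add.
Proof.
move=> x y; have [i [a [b [-> ->]]]] := ind_lim_common2 x y.
by rewrite !ind_lim_class_addE addrC.
Qed.

Lemma ind_lim_add0 : left_id ind_lim_zero ind_lim_add.
Proof.
move=> x; have [i [a ->]] := ind_lim_classP x.
by rewrite (ind_lim_zeroE i) ind_lim_class_addE add0r.
Qed.

Lemma ind_lim_addN : left_inverse ind_lim_zero ind_lim_opp ind_lim_add.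
Proof.
move=> x; have [i [a ->]] := ind_lim_classP x.
by rewrite ind_lim_oppE ind_lim_class_addE addNr -ind_lim_zeroE.
Qed.

HB.instance Definition _ :=
  GRing.isZmodule.Build ind_lim ind_lim_addA ind_lim_addC ind_lim_add0 ind_lim_addN.

End InductiveLimit.

Section MatrixLimit.
Variables (d : nat -> nat) (A : forall i, 'M[int]_(d i.+1, d i)).

Definition mx_lim_step (i : nat) : {additive 'cV[int]_(d i) -> 'cV[int]_(d i.+1)} :=
  mulmx (A i).

Definition mx_lim : zmodType :=
  ind_lim (G := fun i => 'cV[int]_(d i) : zmodType) mx_lim_step.

Definition mx_lim_cone : set mx_lim :=
  [set c | exists (i : nat) (x : 'cV[int]_(d i)),
     (forall k, 0 <= x k 0) /\
     c = ind_lim_class (G := fun i => 'cV[int]_(d i) : zmodType) mx_lim_step x].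

End MatrixLimit.

Arguments mx_lim_cone {d} A.

Definition is_dimension_group (G : zmodType) (Gp : set G) : Prop :=
  is_ordered_group Gp /\
  exists (d : nat -> nat) (A : forall i, 'M[int]_(d i.+1, d i)),
    [/\ forall i, (1 <= d i)%N,
        forall i j k, 0 <= A i j k &
        ordered_group_iso Gp (mx_lim_cone A)].

Definition is_simple_dimension_group (G : zmodType) (Gp : set G) : Prop :=
  is_dimension_group Gp /\
  exists (d : nat -> nat) (A : forall i, 'M[int]_(d i.+1, d i)),
    [/\ forall i, (1 <= d i)%N,
        forall i j k, 0 < A i j k &
        ordered_group_iso Gp (mx_lim_cone A)].

Definition is_simple_dimension_group_with_unit (G : zmodType) (Gp : set G)
    (u : G) : Prop :=
  is_simple_dimension_group Gp /\ is_order_unit Gp u.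

Section ContinuousIntegerFunctions.
Variable X : topologicalType.

Definition continuousZ : {pred X -> int} :=
  fun f => `[< continuous (f : X -> discrete_topology int) >].

Lemma continuousZP (f : X -> int) :
  reflect (continuous (f : X -> discrete_topology int)) (f \in continuousZ).
Proof. exact: asboolP. Qed.

Lemma continuousZ_zmod_closed : zmod_closed continuousZ.
Proof.
split=> [|f g /continuousZP fc /continuousZP gc]; apply/continuousZP => x.
  exact: cvg_cst.
move: (fc x) (gc x) => /discrete_cvg fx /discrete_cvg gx.
have {}fx : \forall y \near x, f y = f x := fx.
have {}gx : \forall y \near x, g y = g x := gx.
apply/discrete_cvg; change (\forall y \near x, (f - g) y = (f - g) x).
apply: filterS2 fx gx => y fy gy.
by rewrite -[(f - g) y]/(f y - g y) fy gy.
Qed.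

HB.instance Definition _ :=
  GRing.isZmodClosed.Build (X -> int) continuousZ continuousZ_zmod_closed.

Definition CZ := {f : X -> int | f \in continuousZ}.

HB.instance Definition _ := SubChoice.on CZ.
HB.instance Definition _ := [SubChoice_isSubZmodule of CZ by <:].

Lemma continuousZ1 : (1 : X -> int) \in continuousZ.
Proof. by apply/continuousZP => x; exact: cvg_cst. Qed.

Definition CZ1 : CZ := exist _ (fun=> 1) continuousZ1.

End ContinuousIntegerFunctions.

Section DynamicalDimensionGroup.
Variables (X : topologicalType) (T : X -> X).

Definition coboundary : {pred CZ X} :=
  fun g => `[< exists f : CZ X, forall x, val g x = val f (T x) - val f x >].

Lemma coboundary_zmod_closed : zmod_closed coboundary.
Proof.
split=> [|u v /asboolP[f Ef] /asboolP[g Eg]]; apply/asboolP.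
  by exists 0 => x; rewrite subr0.
exists (f - g) => x.
by rewrite -[LHS]/(val u x - val v x) Ef Eg /= !fctE; ring.
Qed.

HB.instance Definition _ :=
  GRing.isZmodClosed.Build (CZ X) coboundary coboundary_zmod_closed.

Definition K0 : zmodType := Quotient.quot coboundary.

Definition K0_class (f : CZ X) : K0 := \pi_(Quotient.quot coboundary) f.

Definition K0_cone : set K0 :=
  [set K0_class f | f in [set f | forall x, 0 <= val f x]].

Definition K0_unit : K0 := K0_class (CZ1 X).

End DynamicalDimensionGroup.

Arguments K0_class {X} T f.
Arguments K0_cone {X} T.
Arguments K0_unit {X} T.

Definition full_shift (A : finType) : topologicalType :=
  prod_topology (fun _ : int => discrete_topology A).

Definition full_shift_map (A : finType) (x : full_shift A) : full_shift A :=
  fun i => x (i + 1).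

(* The [k]-th iterate of [full_shift_map], for [k] of either sign. *)
Definition full_shift_pow (A : finType) (k : int) (x : full_shift A) :
    full_shift A :=
  fun i => x (i + k).

(* Invariance is equality, so that the shift restricts to a homeomorphism. *)
Record subshift (A : finType) := Subshift {
  subshift_set :> set (full_shift A);
  subshift_closed : closed subshift_set;
  subshift_invariant : @full_shift_map A @` subshift_set = subshift_set
}.

Section Subshift.
Variables (A : finType) (Y : subshift A).

Lemma subshift_shift_mem (y : set_type Y) :
  full_shift_map (val y) \in subshift_set Y.
Proof.
apply/mem_set; have := subshift_invariant Y => /seteqP[+ _]; apply.
by exists (val y) => //; exact/set_mem/(valP y).
Qed.

Definition subshift_map (y : set_type Y) : set_type Y :=
  exist _ (full_shift_map (val y)) (subshift_shift_mem y).

Definition shift_orbit (y : full_shift A) : set (full_shift A) :=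
  range (fun k : int => full_shift_pow k y).

Definition minimal_subshift : Prop :=
  forall y, subshift_set Y y -> subshift_set Y `<=` closure (shift_orbit y).

Definition word_occurs (n : nat) (w : n.-tuple A) : Prop :=
  exists y, subshift_set Y y /\
    exists i : int, forall k : 'I_n, tnth w k = y (i + (k : nat)%:Z).

Definition complexity (n : nat) : nat :=
  #|[set w : n.-tuple A | `[< word_occurs w >]]%SET|.

End Subshift.

Arguments subshift_map {A} Y.

(* Main.v *)
From HB Require Import structures.
Require Import Defs.
From mathcomp Require Import all_boot all_order all_algebra.
From mathcomp Require Import generic_quotient ring_quotient.
From mathcomp Require Import all_classical all_reals all_analysis.
From mathcomp Require Import zify ring.
Import Order.TTheory GRing.Theory Num.Theory.
Import numFieldNormedType.Exports.
Set Implicit Arguments.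
Unset Strict Implicit.
Unset Printing Implicit Defensive.

(** Why the theorem holds.  Write the group as the limit of the groups Z^(d m)
    along matrices with positive entries.  If the entries of the composed
    matrices stay bounded, then all d m and all matrices are eventually 1
    ([expanding_or_cyclic]), the group is Z with its usual order, and a single
    periodic orbit realizes it ([realize_cyclic]).

    Otherwise a subshift is built from a presentation Z^(k 0) -> Z^(k 1) -> ...
    by matrices B i with large entries.  The letter b of level i+1 is the word
    in which each letter a of level i, taken in increasing order, is repeated
    [B i b a] times.  Expanded down to level 0, a letter a becomes a tower whose
    floors are the pairs (a, t), t being a position in the expansion; a point of
    the shift has at each level a reading, which is a sequence of floors, and
    the readings of successive levels are compatible.  Three features of these words are used.
    A boundary of level i+1 is seen as the last letter followed by the first
    one, so that a point determines its readings locally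
    ([substitution_recognizable]); all words of level i+1 begin with a long run
    of letter 0 and end with a long run of the last letter, so that around a
    boundary the point does not depend on the two adjacent towers
    ([large_entries_proper]); and a window shorter than all runs meets at most
    two of them ([window_run_or_cut]).  The first two give minimality and make
    every continuous integer function a function of the floor at some level;
    summing it along towers identifies K^0 with the limit of the Z^(k i)
    ([K0_iso]).  The third gives at most k i * n + sum of the heights of level i
    words of length n, for n up to the least entry of B i ([tower_complexity]).

    For the complexity bound the least entry of B i has to be large compared
    with k i, with k (i+1) and with the sum of the heights of level i.  The
    original matrices do not have this property, since d (i+1) may be enormous
    compared with the entries that precede it.  The remedy is to interpolate.
    For K arbitrary there are 2 * d m vectors in Z^(d m), with coordinates
    between K and a fixed multiple of K, such that every vector with large and
    comparable coordinates is a positive combination of them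
    ([generators_span]).  The rows of a far enough telescoped matrix are such
    vectors, so that it factors through Z^(2 * d m)
    ([generators_factor]).  These intermediate groups form the new presentation:
    their ranks are known before K is chosen, hence K can be taken as large as
    the sequence p requires ([refine_exists]). *)

(** * Presentations of ordered groups by non-negative matrices *)

Section Presentations.
Local Open Scope ring_scope.
Variables (k : nat -> nat) (B : nat -> nat -> nat -> nat).

Definition incidence (i : nat) (x : nat -> int) : nat -> int :=
  fun b => \sum_(a < k i) x a *+ B i b a.

Fixpoint push (n i : nat) (x : nat -> int) : nat -> int :=
  if n is m.+1 then incidence (m + i) (push m i x) else x.

(** [psi i] is the canonical map of Z^(k i) to the limit; the vectors are
    functions on nat of which only the first k i values matter. *)
Record presents (G : zmodType) (Gp : set G) (psi : nat -> (nat -> int) -> G) : Prop :=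
  Presents {
  presents_eq : forall i x y, (forall a, (a < k i)%N -> x a = y a) -> psi i x = psi i y;
  presents_sub : forall i x y, psi i (fun a => x a - y a) = psi i x - psi i y;
  presents_step : forall i x, psi i.+1 (incidence i x) = psi i x;
  presents_surj : forall g, exists i x, psi i x = g;
  presents_ker : forall i x, psi i x = 0 ->
    exists n, forall b, (b < k (n + i))%N -> push n i x b = 0;
  presents_cone : forall g, Gp g <->
    exists i x, (forall a, (a < k i)%N -> 0 <= x a) /\ psi i x = g }.

Lemma incidence_eq i x y b : (forall a, (a < k i)%N -> x a = y a) ->
  incidence i x b = incidence i y b.
Proof. by move=> xy; apply: eq_bigr => a _; rewrite xy. Qed.

Lemma push_add n m i x : push (n + m) i x = push n (m + i) (push m i x).
Proof. by elim: n => //= n ->; rewrite addnA. Qed.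

(** Coefficients of the product of the matrices of the levels i, ..., i + n - 1.
    The recursion peels off the matrix of level i, because the estimates on rows
    in [generators_factor] use that a row of the product is a positive combination
    of rows of that matrix. *)
Fixpoint entry (n i : nat) : nat -> nat -> nat :=
  if n is m.+1 then fun b j => (\sum_(c < k i.+1) entry m i.+1 b c * B i c j)%N
  else fun b j => (b == j).

Lemma push_entry n i x b : (b < k (n + i))%N ->
  push n i x b = \sum_(j < k i) x j *+ entry n i b j.
Proof.
elim: n i x => [|n IH] i x.
  move=> bi; rewrite (bigD1 (Ordinal bi)) //= eqxx big1 ?addr0 // => j jb.
  by rewrite eq_sym -[_ == _]/(j == Ordinal bi) (negbTE jb).
have -> : push n.+1 i x = push n i.+1 (incidence i x) by rewrite -addn1 push_add.
rewrite addSnnS => bi; rewrite IH //=.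
under eq_bigr do rewrite /incidence -sumrMnl.
rewrite exchange_big; apply: eq_bigr => j _ /=; rewrite -sumrMnr.
by apply: eq_bigr => c _; rewrite -mulrnA mulnC.
Qed.

Lemma push_eq n i x y b : (forall a, (a < k i)%N -> x a = y a) ->
  (b < k (n + i))%N -> push n i x b = push n i y b.
Proof. by move=> xy bi; rewrite !push_entry //; apply: eq_bigr => a _; rewrite xy. Qed.

Lemma push_eq0 n i x b : (forall a, (a < k i)%N -> x a = 0) ->
  (b < k (n + i))%N -> push n i x b = 0.
Proof. by move=> x0 bi; rewrite push_entry // big1 // => a _; rewrite x0 ?mul0rn. Qed.

Lemma entry_add n m i b j : (j < k i)%N ->
  entry (n + m) i b j = (\sum_(c < k (m + i)) entry n (m + i) b c * entry m i c j)%N.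
Proof.
elim: m i j => [|m IH] i j ji.
  rewrite addn0 (bigD1 (Ordinal ji)) //= eqxx muln1 big1 ?addn0 // => c cj.
  by rewrite -[_ == _]/(c == Ordinal ji) (negbTE cj) muln0.
rewrite addnS addSnnS /=.
under eq_bigr do rewrite IH // big_distrl /=.
rewrite exchange_big; apply: eq_bigr => c _ /=; rewrite big_distrr.
by apply: eq_bigr => e _ /=; rewrite mulnA.
Qed.

Section Positive.
Hypothesis k_gt0 : forall i, (0 < k i)%N.
Hypothesis B_gt0 : forall i b a, (b < k i.+1)%N -> (a < k i)%N -> (0 < B i b a)%N.

Lemma incidence_gt0 i x j : (forall a, (a < k i)%N -> 0 <= x a) -> (j < k i)%N ->
  0 < x j -> forall b, (b < k i.+1)%N -> 0 < incidence i x b.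
Proof.
move=> x0 ji xj b bi; rewrite /incidence (bigD1 (Ordinal ji)) //=.
by rewrite ltr_pwDl ?pmulrn_lgt0 ?B_gt0 // sumr_ge0 // => a _; rewrite mulrn_wge0 ?x0.
Qed.

Lemma push_gt0 n i x : (forall a, (a < k i)%N -> 0 < x a) ->
  forall b, (b < k (n + i))%N -> 0 < push n i x b.
Proof.
move=> x0; elim: n => //= n IH b bi.
by apply: (incidence_gt0 (j := 0%N)); rewrite ?IH // => a ai; rewrite ltW ?IH.
Qed.

End Positive.

Section Limit.
Variables (G : zmodType) (Gp : set G) (psi : nat -> (nat -> int) -> G).
Hypothesis psiP : presents Gp psi.

Lemma psi_push n i x : psi (n + i)%N (push n i x) = psi i x.
Proof. by elim: n => //= n <-; rewrite addSn (presents_step psiP). Qed.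

Lemma psi0 i : psi i (fun=> 0) = 0.
Proof.
have := presents_sub psiP i (fun=> 0) (fun=> 0); rewrite subrr => <-.
by apply: presents_eq psiP _ _ _ _.
Qed.

Lemma psiD i x y : psi i (fun a => x a + y a) = psi i x + psi i y.
Proof.
have yN : psi i (fun a => 0 - y a) = - psi i y by rewrite (presents_sub psiP _ (fun=> 0)) psi0 sub0r.
rewrite -[psi i y]opprK -yN -(presents_sub psiP).
by apply: presents_eq psiP _ _ _ _ => a _; rewrite sub0r opprK.
Qed.

(** A non-negative vector with a positive coordinate becomes strictly positive
    after one positive matrix.  The zero class is not an order unit: the opposite
    of the class of (1, ..., 1) would be positive, whereas a strictly positive
    vector is never killed by positive matrices. *)
Lemma order_unit_gt0 u : (forall i, (0 < k i)%N) ->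
  (forall i b a, (b < k i.+1)%N -> (a < k i)%N -> (0 < B i b a)%N) ->
  is_order_unit Gp u ->
  exists i x, (forall a, (a < k i)%N -> 0 < x a) /\ psi i x = u.
Proof.
move=> k_gt0 B_gt0 [/(presents_cone psiP)[i [x [x0 <-]]] unit].
have [[j /andP[ji xj]]|no] := pselect (exists j, (j < k i)%N && (0 < x j)).
  exists i.+1, (incidence i x); split; last exact: presents_step psiP _ _.
  by move=> b; exact: (incidence_gt0 B_gt0 x0 ji).
have ux : psi i x = 0.
  rewrite -(psi0 i); apply: presents_eq psiP _ _ _ _ => a ai.
  apply/eqP; rewrite eq_le x0 // andbT leNgt; apply/negP => xa.
  by apply: no; exists a; rewrite ai.
have [n] := unit (psi 0%N (fun=> 1)); rewrite ux mul0rn sub0r.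
move=> /(presents_cone psiP)[j [y [y0 e]]].
have /(presents_ker psiP)[m mz] : psi j (fun a => y a + push j 0 (fun=> 1) a) = 0.
  by have := psi_push j 0 (fun=> 1); rewrite addn0 psiD e => ->; rewrite addNr.
have : 0 < push m j (fun a => y a + push j 0 (fun=> 1) a) 0%N.
  apply: push_gt0 => // a aj.
  by rewrite ltr_wpDl ?y0 // push_gt0 // addn0.
by rewrite mz ?ltxx.
Qed.

End Limit.

End Presentations.

(** * Cylinders in the full shift *)

Definition agree (T : Type) (N : nat) (n : int) (y y' : int -> T) : Prop :=
  forall m : int, `|m - n|%N <= N -> y m = y' m.

Section FullShift.
Local Open Scope classical_set_scope.
Variable A : finType.
Implicit Types y : full_shift A.

Lemma agreeW (T : Type) N N' n (y y' : int -> T) : N <= N' -> agree N' n y y' -> agree N n y y'.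
Proof. by move=> le ag m mN; apply: ag; exact: leq_trans le. Qed.

Lemma nbhs_coordinate y (m : int) : nbhs y [set y' : full_shift A | y' m = y m].
Proof.
have : nbhs y --> y by apply: cvg_id.
move=> /cvg_sup/(_ m); apply; rewrite nbhsE; exists [set y' : full_shift A | y' m = y m] => //.
split=> //; exists [set a | a = y m] => //; exact: discrete_open.
Qed.

Lemma nbhs_cylinder y N : nbhs y [set y' : full_shift A | agree N 0%R y y'].
Proof.
have FF : Filter (nbhs y) := nbhs_filter y.
elim: N => [|N IH].
  apply: filterS (nbhs_coordinate y 0%R) => y' /= e m m0.
  by have -> : m = 0%R by lia.
have := @filterI _ _ FF _ _ IH (@filterI _ _ FF _ _
  (nbhs_coordinate y N.+1%:Z) (nbhs_coordinate y (- N.+1%:Z)%R)).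
apply: (@filterS _ _ FF) => y' [/= ag [/= e1 e2]] m mN.
have [lt|[->|->]] : `|m - 0|%N <= N \/ m = (N.+1%:Z)%R \/ m = (- N.+1%:Z)%R by lia.
- exact: ag.
- by [].
- by [].
Qed.

(** The cylinders around a point generate a filter which converges in each
    coordinate, hence in the product topology. *)
Lemma cylinder_nbhs y (U : set (full_shift A)) : nbhs y U ->
  exists N, forall y' : full_shift A, agree N 0%R y y' -> U y'.
Proof.
pose F := [set V : set (full_shift A) | exists N, forall y', agree N 0%R y y' -> V y'].
have FF : Filter F.
  split=> [|V W [N VN] [M WM]|V W sub [N VN]]; first by exists 0.
    exists (maxn N M) => y' ag; split; [apply: VN|apply: WM]; apply: agreeW ag;
      [exact: leq_maxl|exact: leq_maxr].
  by exists N => y' /VN/sub.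
suff : cvg_to F (nbhs y) by apply.
apply/cvg_sup => m V; rewrite nbhsE => -[W [[Q oQ <-] Qy] sub].
by exists `|m|%N => y' ag; apply: sub => /=; rewrite -ag // subr0.
Qed.

(** The form in which compactness is used: a cluster point of a sequence agrees
    with terms of arbitrarily large index on every window. *)
Lemma full_shift_cluster (s : nat -> full_shift A) :
  exists y, forall N n0, exists2 i, n0 <= i & agree N 0%R y (s i).
Proof.
have cpt : compact [set: full_shift A].
  have -> : [set: full_shift A] = [set f | forall i : int, [set: discrete_topology A] (f i)].
    by apply/seteqP; split.
  apply: (@tychonoff int (fun=> discrete_topology A) (fun=> setT)) => i.
  by apply: finite_compact; exact: finite_finset.
have [y [_ cl]] := cpt (s @ \oo) _ filterT; exists y => N n0.
have [_ [[i /= le <-] ag]] := cl (s @` [set i | (n0 <= i)%N]) _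
  ltac:(by exists n0 => // i /= ni; exists i) (nbhs_cylinder y N).
by exists i.
Qed.

End FullShift.

(** * Towers and their codings *)

Section Towers.
Variables (k : nat -> nat) (B : nat -> nat -> nat -> nat) (h0 : nat -> nat).

Fixpoint height (i : nat) : nat -> nat :=
  if i is j.+1 then fun b => \sum_(a < k j) B j b a * height j a else h0.

Arguments height : simpl never.

(** Floor t of the tower of letter a at level i is the pair (a, t). *)
Definition tower (i : nat) (p : nat * nat) : bool :=
  (p.1 < k i) && (p.2 < height i p.1).

(** The shift climbs a tower; from the top it may enter any tower at its base. *)
Definition follows (i : nat) (p q : nat * nat) : bool :=
  if p.2.+1 < height i p.1 then q == (p.1, p.2.+1) else q.2 == 0.

Definition offset (i b a : nat) : nat := \sum_(j < a) B i b j * height i j.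

Definition run (i b s : nat) : nat :=
  find (fun a => s < offset i b a.+1) (iota 0 (k i)).

(** The floor of level i that contains the floor p of level i + 1: the tower of b
    is a stack of copies of towers of level i, sorted by letter, [B i b a] copies
    of the tower of a starting at height [offset i b a]. *)
Definition descend (i : nat) (p : nat * nat) : nat * nat :=
  let a := run i p.1 p.2 in (a, (p.2 - offset i p.1 a) %% height i a).

Arguments descend : simpl never.

Fixpoint project (i : nat) (p : nat * nat) : nat * nat :=
  if i is j.+1 then project j (descend j p) else p.

Hypothesis k_gt0 : forall i, 0 < k i.
Hypothesis B_gt0 : forall i b a, b < k i.+1 -> a < k i -> 0 < B i b a.
Hypothesis h0_gt0 : forall a, a < k 0 -> 0 < h0 a.

Lemma offset0 i b : offset i b 0 = 0.
Proof. by rewrite /offset big_ord0. Qed.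

Lemma offsetS i b a : offset i b a.+1 = offset i b a + B i b a * height i a.
Proof. by rewrite /offset big_ord_recr. Qed.

Lemma offset_height i b : offset i b (k i) = height i.+1 b.
Proof. by []. Qed.

Lemma leq_offset i b : {homo offset i b : a a' / a <= a'}.
Proof. by apply: homo_leq => [//|a a' c|a]; [exact: leq_trans|rewrite offsetS leq_addr]. Qed.

Lemma height_gt0 i a : a < k i -> 0 < height i a.
Proof.
elim: i a => [|i IH] a ai; first exact: h0_gt0.
rewrite -offset_height -(prednK (k_gt0 i)) offsetS ltn_addl //.
by rewrite muln_gt0 B_gt0 ?IH ?prednK.
Qed.

Lemma run_eq i b a s : a < k i -> offset i b a <= s < offset i b a.+1 -> run i b s = a.
Proof.
move=> ai /andP[las lsa]; rewrite /run.
have -> : iota 0 (k i) = iota 0 a ++ a :: iota a.+1 (k i - a.+1).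
  by rewrite -[a :: _]/(iota a (k i - a.+1).+1) -iotaD; congr iota; lia.
rewrite find_cat size_iota /= lsa addn0 ifN //; apply/hasPn => j.
by rewrite mem_iota -leqNgt => /andP[_ ja]; apply: leq_trans las; exact: leq_offset.
Qed.

Lemma run_decomposition i b s : s < height i.+1 b ->
  exists a r, [/\ a < k i, r < B i b a * height i a & s = offset i b a + r].
Proof.
rewrite -offset_height; elim: (k i) => [|n IH]; first by rewrite offset0.
case: (ltnP s (offset i b n)) => [/IH [a [r [an rB ->]]] _|le].
  by exists a, r; split=> //; exact: ltnW.
by rewrite offsetS => lt; exists n, (s - offset i b n); split=> //; lia.
Qed.

Lemma descend_run i b a r : a < k i -> r < B i b a * height i a ->
  descend i (b, offset i b a + r) = (a, r %% height i a).
Proof.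
move=> ai rB; rewrite /descend /= (@run_eq _ _ a) // ?addKn //.
by rewrite offsetS leq_addr ltn_add2l.
Qed.

Lemma ltn_offset_height i b a r : a < k i -> r < B i b a * height i a ->
  offset i b a + r < height i.+1 b.
Proof.
move=> ai rB; rewrite -offset_height.
by apply: leq_trans (leq_offset i b ai); rewrite offsetS ltn_add2l.
Qed.

Lemma tower_descend i p : tower i.+1 p -> tower i (descend i p).
Proof.
case: p => b s /andP[/= bi /run_decomposition[a [r [ai rB ->]]]].
by rewrite descend_run // /tower /= ai ltn_pmod ?height_gt0.
Qed.

Lemma tower_project i p : tower i p -> tower 0 (project i p).
Proof. by elim: i p => //= i IH p /tower_descend/IH. Qed.

Lemma descend_base i b : b < k i.+1 -> descend i (b, 0) = (0, 0).
Proof.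
move=> bi; have := @descend_run i b 0 0; rewrite offset0 addn0 mod0n; apply=> //.
by rewrite muln_gt0 B_gt0 ?height_gt0.
Qed.

Lemma modn_predM c n : 0 < c -> 0 < n -> (c * n).-1 %% n = n.-1.
Proof.
case: c n => // c [//|n] _ _; rewrite mulSn addSn /= addnC modnMDl modn_small //.
Qed.

Lemma descend_top i b : b < k i.+1 ->
  descend i (b, (height i.+1 b).-1) = ((k i).-1, (height i (k i).-1).-1).
Proof.
move=> bi; have lt : (k i).-1 < k i by rewrite prednK.
have Bh0 : 0 < B i b (k i).-1 * height i (k i).-1.
  by rewrite muln_gt0 B_gt0 ?height_gt0.
have -> : (height i.+1 b).-1 = offset i b (k i).-1 + (B i b (k i).-1 * height i (k i).-1).-1.
  by rewrite -offset_height -{1}(prednK (k_gt0 i)) offsetS; lia.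
by rewrite descend_run ?modn_predM ?B_gt0 ?height_gt0 //; lia.
Qed.

Lemma modnS_small m n : (m %% n).+1 < n -> m.+1 %% n = (m %% n).+1.
Proof. by move=> lt; rewrite -addn1 -modnDml addn1 modn_small. Qed.

Lemma modnS_wrap m n : 0 < n -> ~~ ((m %% n).+1 < n) -> m.+1 %% n = 0.
Proof.
move=> n0 lt; rewrite -addn1 -modnDml addn1.
have -> : (m %% n).+1 = n by have := ltn_pmod m n0; lia.
by rewrite modnn.
Qed.

Lemma follows_descend i b s : b < k i.+1 -> s.+1 < height i.+1 b ->
  follows i (descend i (b, s)) (descend i (b, s.+1)).
Proof.
move=> bi sh; have /run_decomposition[a [r [ai rB es]]] := ltnW sh.
have h0a := height_gt0 ai; rewrite es descend_run //.
case: (ltnP r.+1 (B i b a * height i a)) => [lt|ge].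
  rewrite -addnS descend_run // /follows /=; case: ifP => lt'.
    by rewrite modnS_small.
  by rewrite modnS_wrap ?lt'.
have er : r.+1 = B i b a * height i a by apply/eqP; rewrite eqn_leq rB ge.
have -> : (offset i b a + r).+1 = offset i b a.+1 by rewrite offsetS -er addnS.
have ai' : a.+1 < k i.
  rewrite ltnNge; apply/negP => le; move: sh; rewrite -offset_height es -addnS er -offsetS.
  by rewrite ltnNge leq_offset.
rewrite -[offset i b a.+1]addn0 descend_run ?mod0n; last 2 first.
- by [].
- by rewrite muln_gt0 B_gt0 ?height_gt0.
rewrite /follows /= ifN //; apply/negP => lt.
have := modnS_small lt; rewrite er modnMl; lia.
Qed.

Lemma descend0 i b r : b < k i.+1 -> r < B i b 0 * height i 0 ->
  descend i (b, r) = (0, r %% height i 0).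
Proof. by move=> bi rB; have := descend_run (k_gt0 i) rB; rewrite offset0. Qed.

Lemma sumn_period (V : zmodType) (F : nat -> V) c n :
  (\sum_(r < c * n) F (r %% n)%N = (\sum_(t < n) F t) *+ c)%R.
Proof.
elim: c => [|c IH]; first by rewrite mul0n big_ord0 mulr0n.
rewrite mulrSr -IH mulSn addnC -(big_mkord xpredT (fun r => F (r %% n)%N)).
rewrite (big_cat_nat (n := c * n)) ?leq_addr //= big_mkord; congr (_ + _)%R.
rewrite -{1}[c * n]add0n big_addn addKn big_mkord; apply: eq_bigr => t _.
by rewrite addnC modnMDl modn_small.
Qed.

(** The incidence matrix carries the sums along towers of one level to those of the
    next one: this is what makes the limit of the groups Z^(k i) appear in K^0. *)
Lemma sum_descend (V : zmodType) (F : nat * nat -> V) i b : b < k i.+1 ->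
  (\sum_(s < height i.+1 b) F (descend i (b, s : nat)) =
   \sum_(a < k i) (\sum_(t < height i a) F (a : nat, t : nat)) *+ B i b a)%R.
Proof.
move=> bi; rewrite -offset_height.
suff gen n : n <= k i -> (\sum_(s < offset i b n) F (descend i (b, s : nat)) =
   \sum_(a < n) (\sum_(t < height i a) F (a : nat, t : nat)) *+ B i b a)%R by exact: gen.
elim: n => [|n IH] ni; first by rewrite offset0 !big_ord0.
rewrite big_ord_recr /= -IH ?(ltnW ni) // offsetS.
rewrite -(big_mkord xpredT (fun s => F (descend i (b, s)))).
rewrite (big_cat_nat (n := offset i b n)) ?leq_addr //= big_mkord; congr (_ + _)%R.
rewrite -{1}[offset i b n]add0n big_addn addKn big_mkord.
rewrite -(sumn_period (fun t => F (n, t))).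
by apply: eq_bigr => r _; rewrite addnC descend_run.
Qed.

Definition tower_seq (i : nat) (z : int -> nat * nat) : Prop :=
  forall n, tower i (z n) /\ follows i (z n) (z (n + 1)%R).

Lemma tower_seq_shift i z m : tower_seq i z -> tower_seq i (fun n => z (n + m)%R).
Proof. by move=> zi n; have [] := zi (n + m)%R; rewrite addrAC. Qed.

Lemma tower_seqS i z n a t : tower_seq i z -> z n = (a, t) -> t.+1 < height i a ->
  z (n + 1)%R = (a, t.+1).
Proof. by move=> zi zn lt; have [_] := zi n; rewrite zn /follows lt => /eqP. Qed.

Lemma tower_seqP i z n a t : tower_seq i z -> z n = (a, t.+1) -> z (n - 1)%R = (a, t).
Proof.
move=> zi zn; have [_] := zi (n - 1)%R; rewrite subrK zn /follows.
by case: (z (n - 1)%R) => a' t' /=; case: ifP => // _ /eqP[-> ->].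
Qed.

Lemma tower_seq_fwd i z n a t r : tower_seq i z -> z n = (a, t) ->
  t + r < height i a -> z (n + r%:Z)%R = (a, t + r).
Proof.
move=> zi zn; elim: r => [|r IH] lt; first by rewrite addr0 addn0.
have -> : (n + r.+1%:Z = n + r%:Z + 1)%R by lia.
by rewrite addnS; apply: (tower_seqS zi); [apply: IH|]; lia.
Qed.

Lemma tower_seq_bwd i z n a t r : tower_seq i z -> z n = (a, t) ->
  r <= t -> z (n - r%:Z)%R = (a, t - r).
Proof.
move=> zi zn; elim: r => [|r IH] le; first by rewrite subr0 subn0.
have -> : (n - r.+1%:Z = n - r%:Z - 1)%R by lia.
apply: (tower_seqP zi); rewrite IH; last exact: ltnW.
by congr (_, _); lia.
Qed.

Lemma tower_seq_end i z n a t : tower_seq i z -> z n = (a, t) ->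
  (z (n + (height i a - t)%:Z)%R).2 = 0.
Proof.
move=> zi zn; have [] := zi n; rewrite zn => /andP[/= _ lt] _.
have := tower_seq_fwd (r := (height i a - t).-1) zi zn.
move=> /(_ ltac:(lia)) zl; have [_] := zi (n + (height i a - t).-1%:Z)%R.
have -> : (n + (height i a - t).-1%:Z + 1 = n + (height i a - t)%:Z)%R by lia.
by rewrite zl /follows ifN; [move=> /eqP|move=> /=; lia].
Qed.

Lemma tower_seq_start i z n a t : tower_seq i z -> z n = (a, t) ->
  (z (n - t.+1%:Z)%R).2 = (height i (z (n - t.+1%:Z)%R).1).-1.
Proof.
move=> zi zn; have z0 := tower_seq_bwd zi zn (leqnn t).
have [/andP[_ lt]] := zi (n - t.+1%:Z)%R.
have -> : (n - t.+1%:Z + 1 = n - t%:Z)%R by lia.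
rewrite z0 subnn /follows; case: (z (n - t.+1%:Z)%R) lt => a' t' /= lt.
by case: ifP => [_ /eqP[]//|/negbT ge _]; lia.
Qed.

Lemma tower_seq_descend i z : tower_seq i.+1 z -> tower_seq i (descend i \o z).
Proof.
move=> zi n; have [zn fn] := zi n; split; first exact: tower_descend.
rewrite [(_ \o z) n]/= [(_ \o z) (n + 1)%R]/=.
case: (z n) zn fn => b s /andP[/= bi lt]; rewrite {1}/follows /=.
case: ifP => [lt' /eqP -> | ge /eqP e]; first exact: follows_descend.
have [/andP[]] := zi (n + 1)%R; case: (z (n + 1)%R) e => b' s' /= -> b'i _ _.
have -> : s = (height i.+1 b).-1 by lia.
rewrite descend_top // descend_base // /follows ifN //=.
by rewrite prednK ?ltnn // height_gt0 ?prednK.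
Qed.

(** Recognizability is asked in its local form: the uniqueness of the reading
    alone would not directly make it continuous. *)
Definition recognizable_towers : Prop := forall i, exists M, forall z z' n,
  tower_seq i.+1 z -> tower_seq i.+1 z' ->
  agree M n (descend i \o z) (descend i \o z') -> z n = z' n.

(** Only the part of the window outside the tower is at stake.  This is the property
    of S-adic systems whose words share long prefixes and suffixes. *)
Definition proper_towers : Prop := forall N, exists i, forall z z' n,
  tower_seq i z -> tower_seq i z' -> z n = z' n ->
  agree N n (project i \o z) (project i \o z').

Lemma project_inj : recognizable_towers -> forall i, exists M, forall z z' n,
  tower_seq i z -> tower_seq i z' ->
  agree M n (project i \o z) (project i \o z') -> z n = z' n.
Proof.
move=> rec; elim=> [|i [M IH]]; first by exists 0 => z z' n _ _; apply; rewrite subrr.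
have [M' rM'] := rec i; exists (M' + M) => z z' n zi zi' ag.
apply: rM' => // m mn; apply: (IH (descend i \o z) (descend i \o z')).
- exact: tower_seq_descend.
- exact: tower_seq_descend.
- by move=> m' m'm; apply: ag; lia.
Qed.

Lemma tower_seq_occurs i z p : tower_seq i.+1 z -> tower i p -> exists n, descend i (z n) = p.
Proof.
case: p => a t zi /andP[/= ai ti]; have [] := zi 0%R.
case e : (z 0%R) => [b s] /andP[/= bi si] _.
have z0 := tower_seq_bwd zi e (leqnn s).
have tB : t < B i b a * height i a by apply: leq_trans ti _; rewrite leq_pmull ?B_gt0.
exists (0 - s%:Z + (offset i b a + t)%:Z)%R.
rewrite (tower_seq_fwd zi z0) subnn add0n ?ltn_offset_height //.
by rewrite descend_run // modn_small.
Qed.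

Lemma leq_run i b s s' : s <= s' -> run i b s <= run i b s'.
Proof. by move=> ss'; apply: sub_find => a /=; exact: leq_ltn_trans. Qed.

(** Inside a tower the letter of level i never decreases, whereas it drops from
    k i - 1 to 0 at a boundary. *)
Lemma no_inner_cut i b s : 1 < k i ->
  descend i (b, s) = ((k i).-1, (height i (k i).-1).-1) -> descend i (b, s.+1) <> (0, 0).
Proof.
by move=> k1 [e _] [e' _]; have := leq_run i b (leqnSn s); rewrite e e'; lia.
Qed.

(** The bases of level i inside a tower count the entries of its row; thus the
    word of a tower determines the row. *)
Lemma sum_cut_letters i b a : b < k i.+1 -> a < k i ->
  (\sum_(s < height i.+1 b) (descend i (b, s : nat) == (a, 0%N))%:R = (B i b a)%:R :> int)%R.
Proof.
move=> bi ai; rewrite (sum_descend (fun p => (p == (a, 0%N))%:R : int)%R) //.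
rewrite (bigD1 (Ordinal ai)) //= [X in (_ + X)%R]big1 ?addr0 => [|j ja].
  have h0a := height_gt0 ai.
  rewrite (bigD1 (Ordinal h0a)) //= eqxx [X in (_ + X)%R]big1 ?addr0 // => t t0.
  by rewrite xpair_eqE eqxx /= -[_ == _]/(t == Ordinal h0a) (negbTE t0).
rewrite big1 ?mul0rn // => t _.
by rewrite xpair_eqE -[X in X && _]/(j == Ordinal ai) (negbTE ja).
Qed.

Section Recognizability.
Hypothesis k_gt1 : forall i, 1 < k i.
Hypothesis B_inj : forall i b b', b < k i.+1 -> b' < k i.+1 ->
  (forall a, a < k i -> B i b a = B i b' a) -> b = b'.

(** If the second reading were higher in its tower, then the boundary below the
    first reading would be seen inside that tower. *)
Lemma recognize_cut i z z' n : tower_seq i.+1 z -> tower_seq i.+1 z' ->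
  agree (z n).2.+1 n (descend i \o z) (descend i \o z') -> (z' n).2 <= (z n).2.
Proof.
case e : (z n) => [b s]; case e' : (z' n) => [b' s'] /= zi zi' ag.
rewrite leqNgt; apply/negP => lt.
have eb := tower_seq_bwd zi e (leqnn s); rewrite subnn in eb.
have eb' := tower_seq_bwd zi' e' (ltnW lt).
have et := tower_seq_start zi e.
have et' := tower_seq_bwd zi' e' lt.
have [/andP[bi _] _] := zi (n - s%:Z)%R; rewrite eb /= in bi.
have [/andP[ci _] _] := zi (n - s.+1%:Z)%R.
(* at n - s the first reading is at a base, and just below it at a top *)
have := ag (n - s%:Z)%R ltac:(lia); rewrite /= eb eb' descend_base // => d0.
have := ag (n - s.+1%:Z)%R ltac:(lia); rewrite /= et'.
rewrite [z _]surjective_pairing et descend_top // => d1.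
apply: (no_inner_cut (k_gt1 i) (esym d1)); rewrite d0; congr (descend _ (_, _)); lia.
Qed.

(** Both readings see the same boundaries, hence give the same floor and the same
    height; then the words agree, hence the rows, hence the letters. *)
Lemma substitution_recognizable : recognizable_towers.
Proof.
move=> i; set H := \sum_(b < k i.+1) height i.+1 b.
have leH b : b < k i.+1 -> height i.+1 b <= H.
  by move=> bi; rewrite /H (bigD1 (Ordinal bi)) //= leq_addr.
exists H.+1 => z z' n zi zi' ag.
have agm m N : `|m - n|%N + N <= H.+1 -> agree N m (descend i \o z) (descend i \o z').
  by move=> mn m' m'm; apply: ag; lia.
have agm' m N : `|m - n|%N + N <= H.+1 -> agree N m (descend i \o z') (descend i \o z).
  by move=> mn m' m'm; apply/esym/ag; lia.
have [tz _] := zi n; have [tz' _] := zi' n.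
case e : (z n) tz => [b s] /andP[/= bi si]; case e' : (z' n) tz' => [b' s'] /andP[/= b'i s'i].
have sH := leq_trans si (leH _ bi); have s'H := leq_trans s'i (leH _ b'i).
have ss : s = s'.
  have := @recognize_cut i z z' n zi zi'; have := @recognize_cut i z' z n zi' zi.
  rewrite e e' /= => /(_ (agm' n s'.+1 ltac:(lia))) l1 /(_ (agm n s.+1 ltac:(lia))) l2; lia.
subst s'.
have length y y' c c' : tower_seq i.+1 y -> tower_seq i.+1 y' -> y n = (c, s) -> y' n = (c', s) ->
    c < k i.+1 -> s < height i.+1 c ->
    (forall m, `|m - n|%N + 1 <= H.+1 -> agree 1 m (descend i \o y) (descend i \o y')) ->
    height i.+1 c' <= height i.+1 c.
  move=> yi yi' ey ey' ci sc agy; rewrite leqNgt; apply/negP => lt.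
  have y0 := tower_seq_end yi ey; have hc := leH _ ci.
  have y'0 := tower_seq_fwd (r := height i.+1 c - s) yi' ey' ltac:(lia).
  have := @recognize_cut i y y' (n + (height i.+1 c - s)%:Z)%R yi yi'.
  rewrite y0 y'0 /=; move=> /(_ (agy (n + (height i.+1 c - s)%:Z)%R ltac:(lia))); lia.
have hh : height i.+1 b = height i.+1 b'.
  apply/eqP; rewrite eqn_leq; apply/andP; split.
    by apply: (length z' z b' b zi' zi e' e b'i s'i) => m mn; apply: agm'.
  by apply: (length z z' b b' zi zi' e e' bi si) => m mn; apply: agm.
have dd r : r < height i.+1 b -> descend i (b, r) = descend i (b', r).
  move=> rh; have hH := leH _ bi.
  have z0 := tower_seq_bwd zi e (leqnn s); have z0' := tower_seq_bwd zi' e' (leqnn s).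
  have := ag (n - s%:Z + r%:Z)%R ltac:(lia); rewrite /=.
  by rewrite (tower_seq_fwd zi z0) ?(tower_seq_fwd zi' z0') ?subnn ?add0n // -?hh.
congr (_, _); apply: (B_inj bi b'i) => a ai.
(* equal words have equal numbers of bases of each letter *)
suff : ((B i b a)%:R = (B i b' a)%:R :> int)%R by lia.
rewrite -!sum_cut_letters // -hh; apply: eq_bigr => r _; congr (_%:R)%R.
by rewrite dd.
Qed.

End Recognizability.

(** After leaving a tower one reads the initial run of letter 0, before entering
    it the final run of the last letter; both last for more than N copies in every
    tower. *)
Lemma large_entries_proper :
  (forall N, exists i, forall b a, b < k i.+1 -> a < k i -> N < B i b a) -> proper_towers.
Proof.
move=> large N; have [i iN] := large N; exists i.+1 => z z' n zi zi' zn m mn /=.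
congr (project i _).
case e : (z n) => [b s]; rewrite e in zn; have e' := esym zn.
have [/andP[]] := zi n; rewrite e /= => bi sh _.
have kp : (k i).-1 < k i by rewrite prednK.
have Bh c a : c < k i.+1 -> a < k i -> N < B i c a * height i a.
  by move=> ci ai; apply: leq_trans (iN c a ci ai) _; rewrite leq_pmulr ?height_gt0.
case: (leP n m) => nm; last first.
  have {nm mn} [r [-> r0 rN]] : exists r, [/\ m = (n - r%:Z)%R, 0 < r & r <= N].
    by exists `|n - m|%N; split; lia.
  case: (leqP r s) => rs; first by rewrite (tower_seq_bwd zi e) ?(tower_seq_bwd zi' e').
  have top y : tower_seq i.+1 y -> y n = (b, s) ->
      descend i (y (n - r%:Z)%R) = ((k i).-1,
        (N.+1 * height i (k i).-1 - (r - s)) %% height i (k i).-1).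
    move=> yi ey; have es := tower_seq_start yi ey.
    have [/andP[ci _] _] := yi (n - s.+1%:Z)%R.
    case ec : (y (n - s.+1%:Z)%R) es ci => [c t] /= et ci; subst t.
    have hB := Bh _ _ ci kp.
    have hc : height i.+1 c = offset i c (k i).-1 + B i c (k i).-1 * height i (k i).-1.
      by rewrite -offset_height -{1}(prednK (k_gt0 i)) offsetS.
    have -> : (n - r%:Z = n - s.+1%:Z - (r - s.+1)%:Z)%R by lia.
    have h1 := height_gt0 kp; have Nh : N.+1 <= N.+1 * height i (k i).-1 by rewrite leq_pmulr.
    have lt : B i c (k i).-1 * height i (k i).-1 - (r - s) < B i c (k i).-1 * height i (k i).-1 by lia.
    rewrite (tower_seq_bwd yi ec) ?hc; last lia.
    have -> : (N.+1 * height i (k i).-1 - (r - s)) %% height i (k i).-1 =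
        (B i c (k i).-1 * height i (k i).-1 - (r - s)) %% height i (k i).-1.
      rewrite -(subnK (iN _ _ ci kp)) mulnDl -addnBA ?modnMDl //; lia.
    rewrite -(descend_run kp lt); congr (descend _ (_, _)); lia.
  by rewrite (top z) ?(top z').
have {nm mn} [r [-> rN]] : exists r, m = (n + r%:Z)%R /\ r <= N.
  by exists `|n - m|%N; split; lia.
case: (ltnP (s + r) (height i.+1 b)) => rs.
  by rewrite (tower_seq_fwd zi e) ?(tower_seq_fwd zi' e').
have next y : tower_seq i.+1 y -> y n = (b, s) ->
    descend i (y (n + r%:Z)%R) = (0, (r - (height i.+1 b - s)) %% height i 0).
  move=> yi ey; have es := tower_seq_end yi ey.
  have [/andP[ci _] _] := yi (n + (height i.+1 b - s)%:Z)%R.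
  case ec : (y _) es ci => [c t] /= t0 ci; subst t; have hB := Bh _ _ ci (k_gt0 i).
  have -> : (n + r%:Z = n + (height i.+1 b - s)%:Z + (r - (height i.+1 b - s))%:Z)%R by lia.
  have lt : r - (height i.+1 b - s) < B i c 0 * height i 0 by lia.
  have := ltn_offset_height (k_gt0 i) lt; rewrite offset0 add0n => lt'.
  by rewrite (tower_seq_fwd yi ec) ?add0n // descend0.
by rewrite (next z) ?(next z').
Qed.

Definition next_letter (i a : nat) : nat := if a.+1 < k i then a.+1 else 0.

Definition run_word (i a t r : nat) : nat * nat := (a, (t + r) %% height i a).

(** What is read in a window in which the run of a ends after e steps; the phase
    is counted backwards from the end of the run, [height i a * e] being a multiple
    of the period that keeps the truncated subtraction exact. *)
Definition cut_word (i a e r : nat) : nat * nat :=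
  if r < e then (a, (height i a * e + r - e) %% height i a)
  else (next_letter i a, (r - e) %% height i (next_letter i a)).

(** Every run has at least N floors, so that a window of length N contains at most
    one change of run, and the letter after the change is the next one cyclically. *)
Lemma window_run_or_cut i z n N : tower_seq i.+1 z ->
  (forall b a, b < k i.+1 -> a < k i -> N <= B i b a) ->
  (exists a t, tower i (a, t) /\
     forall r, r < N -> descend i (z (n + r%:Z)%R) = run_word i a t r) \/
  (exists a e, [/\ a < k i, e < N &
     forall r, r < N -> descend i (z (n + r%:Z)%R) = cut_word i a e r]).
Proof.
move=> zi leB; case e : (z n) => [b s]; have [/andP[]] := zi n; rewrite e /= => bi sh _.
have [a [r0 [ai r0B es]]] := run_decomposition sh; subst s.
have h0a := height_gt0 ai.
have Bh c j : c < k i.+1 -> j < k i -> N <= B i c j * height i j.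
  by move=> ci ji; apply: leq_trans (leB _ _ ci ji) _; rewrite leq_pmulr ?height_gt0.
have fwd r : r0 + r < B i b a * height i a ->
    descend i (z (n + r%:Z)%R) = (a, (r0 + r) %% height i a).
  move=> lt; rewrite (tower_seq_fwd zi e) -addnA ?descend_run //.
  exact: ltn_offset_height.
case: (leqP (r0 + N) (B i b a * height i a)) => le.
  left; exists a, (r0 %% height i a); split; first by rewrite /tower /= ai ltn_pmod.
  by move=> r rN; rewrite fwd /run_word ?modnDml //; lia.
right; exists a, (B i b a * height i a - r0); split=> [//||r rN]; first lia.
rewrite /cut_word; case: ifP => re.
  rewrite fwd; last lia.
  congr (_, _); set q := _ - r0.
  have -> : r0 + r = B i b a * height i a - (q - r) by lia.
  have -> : height i a * q + r - q = height i a * q - (q - r) by lia.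
  apply/eqP; rewrite -(eqn_modDr (q - r)) !subnK; first by rewrite modnMl modnMr.
    by apply: leq_trans (leq_subr _ _) _; rewrite leq_pmull.
  lia.
have h0n : 0 < height i (next_letter i a).
  by apply: height_gt0; rewrite /next_letter; case: ifP => // _.
have er : (n + r%:Z = n + (B i b a * height i a - r0)%:Z + (r - (B i b a * height i a - r0))%:Z)%R by lia.
move: (r - _) er (leq_ltn_trans (leq_subr (B i b a * height i a - r0) r) rN) => q -> qN.
rewrite /next_letter in h0n *; case: ifP h0n => ai1 h0n.
  have Bhn := leq_trans qN (Bh _ _ bi ai1).
  have e1 : offset i b a + r0 + (B i b a * height i a - r0 + q) = offset i b a.+1 + q.
    by rewrite offsetS; lia.
  rewrite -addrA -PoszD (tower_seq_fwd zi e) e1 ?descend_run //.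
  exact: ltn_offset_height.
have ak : a.+1 = k i by lia.
have := tower_seq_end zi e; rewrite -offset_height -ak offsetS.
have -> : offset i b a + B i b a * height i a - (offset i b a + r0) = B i b a * height i a - r0 by lia.
have [/andP[ci _] _] := zi (n + (B i b a * height i a - r0)%:Z)%R.
case ec : (z _) ci => [c t] /= ci t0; subst t.
have Bhn := leq_trans qN (Bh _ _ ci (k_gt0 i)).
have := ltn_offset_height (k_gt0 i) Bhn; rewrite offset0 add0n => lt.
by rewrite (tower_seq_fwd zi ec) ?add0n // descend0.
Qed.

(** * The dimension group of a tower system *)

Section DimensionGroup.
Local Open Scope ring_scope.
Local Notation incidence := (incidence k B).
Local Notation push := (push k B).
Local Notation presents := (presents k B).

Lemma inj_surj_bijective (S T : Type) (f : S -> T) :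
  injective f -> (forall y, exists x, f x = y) -> bijective f.
Proof.
move=> finj fsurj; have [g gK] := choice fsurj.
by exists g => // x; apply: finj; rewrite gK.
Qed.

Section TowerModel.
Variables (X : topologicalType) (T : X -> X) (loc : nat -> X -> nat * nat).
Hypothesis loc_tower : forall i x, tower i (loc i x).
Hypothesis loc_follows : forall i x, follows i (loc i x) (loc i (T x)).
Hypothesis loc_descend : forall i x, loc i x = descend i (loc i.+1 x).
Hypothesis loc_surj : forall i p, tower i p -> exists x, loc i x = p.
Hypothesis loc_factor : forall f : CZ X, exists i F, forall x, val f x = F (loc i x).
Hypothesis loc_continuous : forall i (F : nat * nat -> int),
  (fun x => F (loc i x)) \in @Defs.continuousZ X.

Variables (G : zmodType) (Gp : set G) (u : G) (psi : nat -> (nat -> int) -> G).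
Hypothesis psiP : presents Gp psi.
Hypothesis psi_unit : psi 0%N (fun a => (h0 a)%:Z) = u.

Definition CZ_of_loc (i : nat) (F : nat * nat -> int) : CZ X :=
  exist _ (fun x => F (loc i x)) (loc_continuous i F).

Definition factors (i : nat) (F : nat * nat -> int) (f : CZ X) : Prop :=
  forall x, val f x = F (loc i x).

Definition tower_sum (i : nat) (F : nat * nat -> int) : nat -> int :=
  fun a => \sum_(t < height i a) F (a, t : nat).

Lemma tower_sum_descend i F b : (b < k i.+1)%N ->
  tower_sum i.+1 (F \o descend i) b = incidence i (tower_sum i F) b.
Proof. by move=> bi; rewrite /tower_sum sum_descend. Qed.

Lemma factors_up i F f n : factors i F f -> exists F', factors (n + i) F' f /\
  forall a, (a < k (n + i))%N -> tower_sum (n + i) F' a = push n i (tower_sum i F) a.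
Proof.
move=> fF; elim: n => [|n [F' [fF' eF']]]; first by exists F.
exists (F' \o descend (n + i)); split=> [x|a ai]; first by rewrite fF' loc_descend.
by rewrite addSn tower_sum_descend //; apply: incidence_eq.
Qed.

Lemma psi_factors_up i F f n : factors i F f -> exists F', factors (n + i) F' f /\
  psi (n + i)%N (tower_sum (n + i) F') = psi i (tower_sum i F).
Proof.
move=> /(factors_up n)[F' [fF' e]]; exists F'; split=> //.
by rewrite -[RHS](psi_push psiP n); apply: presents_eq psiP _ _ _ _.
Qed.

Lemma factors_tower_sum i F F' f : factors i F f -> factors i F' f ->
  psi i (tower_sum i F) = psi i (tower_sum i F').
Proof.
move=> fF fF'; apply: presents_eq psiP _ _ _ _ => a ai; apply: eq_bigr => t _.
by have [|x <-] := @loc_surj i (a, t : nat); rewrite -?fF -?fF' // /tower /= ai /=.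
Qed.

(** A function of the floor at one level is a function of the floor at all higher
    levels, and [psi] does not see the change of level. *)
Lemma factors_psi i j F F' f : factors i F f -> factors j F' f ->
  psi i (tower_sum i F) = psi j (tower_sum j F').
Proof.
move=> /(psi_factors_up j)[F1 [f1 <-]] /(psi_factors_up i)[F2 [f2 <-]].
by rewrite addnC in f2 *; exact: factors_tower_sum f1 f2.
Qed.

(** This is the isomorphism of [K0_iso] before the quotient by coboundaries. *)
Lemma theta_exists : exists theta : CZ X -> G,
  forall f i F, factors i F f -> theta f = psi i (tower_sum i F).
Proof.
have [w wP] := choice (fun f => let: ex_intro i (ex_intro F fF) := loc_factor f in
  ex_intro (fun iF => factors iF.1 iF.2 f) (i, F) fF).
by exists (fun f => psi (w f).1 (tower_sum (w f).1 (w f).2)) => f i F; apply: factors_psi.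
Qed.

Lemma common_factors f g : exists i F F', factors i F f /\ factors i F' g.
Proof.
have [i [F fF]] := loc_factor f; have [j [F' gF']] := loc_factor g.
have [F1 [f1 _]] := factors_up j fF; have [F2 [f2 _]] := factors_up i gF'.
by rewrite addnC in f2; exists (j + i)%N, F1, F2.
Qed.

Section Theta.
Variable theta : CZ X -> G.
Hypothesis thetaE : forall f i F, factors i F f -> theta f = psi i (tower_sum i F).

Lemma theta_sub f g : theta (f - g) = theta f - theta g.
Proof.
have [i [F [F' [fF gF']]]] := common_factors f g.
rewrite (thetaE fF) (thetaE gF') -(presents_sub psiP).
rewrite (@thetaE _ i (fun p => F p - F' p)) => [|x]; last first.
  by rewrite -[LHS]/(val f x - val g x) fF gF'.
by apply: presents_eq psiP _ _ _ _ => a _; rewrite /tower_sum sumrB.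
Qed.

(** At level i + 1 the sums along towers telescope, and their two ends cancel:
    the transfer function depends on the floor of level i, and all towers of level
    i + 1 start at the floor (0, 0) of level i. *)
Lemma theta_coboundary f : f \in coboundary T -> theta f = 0.
Proof.
move=> /asboolP[g fg]; have [i [F [E [fF gE]]]] := common_factors f g.
have fF1 : factors i.+1 (F \o descend i) f by move=> x; rewrite fF loc_descend.
have z0 : psi i.+1 (fun=> 0 - 0) = 0 by rewrite (presents_sub psiP _ (fun=> 0) (fun=> 0)) subrr.
rewrite (thetaE fF1) -z0; apply: presents_eq psiP _ _ _ _ => b bi; rewrite subr0.
have FE p x : loc i.+1 x = p -> F (descend i p) = E (loc i (T x)) - E (descend i p).
  by move=> <-; rewrite -loc_descend -fF -gE -gE fg.
have hb := height_gt0 bi.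
have telescope n : (n < height i.+1 b)%N ->
    \sum_(s < n) F (descend i (b, s : nat)) = E (descend i (b, n)) - E (descend i (b, 0%N)).
  elim: n => [|n IH] lt; first by rewrite big_ord0 subrr.
  rewrite big_ord_recr /= IH ?(ltnW lt) //.
  have [|x ex] := @loc_surj i.+1 (b, n); first by rewrite /tower /= bi ltnW.
  have := loc_follows i.+1 x; rewrite ex /follows /= lt => /eqP ex'.
  by rewrite (FE _ _ ex) (loc_descend i (T x)) ex'; ring.
rewrite /tower_sum -(prednK hb) big_ord_recr /= telescope ?prednK //.
have [|x ex] := @loc_surj i.+1 (b, (height i.+1 b).-1); first by rewrite /tower /= bi prednK /=.
have := loc_follows i.+1 x; rewrite ex /follows /= prednK // ltnn => /eqP e0.
have := loc_tower i.+1 (T x); rewrite (FE _ _ ex) (loc_descend i (T x)).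
case: (loc i.+1 (T x)) e0 => c t /= -> /andP[/= ci _].
by rewrite !descend_base //; ring.
Qed.

(** If all sums along towers vanish, the partial sums from the base define a
    transfer function, continuous because it depends on the floor only. *)
Lemma theta_ker f : theta f = 0 -> f \in coboundary T.
Proof.
have [i [F fF]] := loc_factor f; rewrite (thetaE fF) => /(presents_ker psiP)[n].
have [F' [fF' eF']] := factors_up n fF => z.
have {z eF'} s0 a : (a < k (n + i))%N -> tower_sum (n + i) F' a = 0 by move=> ai; rewrite eF' ?z.
move: {i F fF}(n + i)%N F' fF' s0 => i F fF s0.
pose E p : int := \sum_(t < p.2) F (p.1, t : nat).
apply/asboolP; exists (CZ_of_loc i E) => x /=; rewrite fF.
have := loc_follows i x; have := loc_tower i x.
case: (loc i x) => a t /andP[/= ai ti]; rewrite /follows /=; case: ifP => [lt /eqP ->|ge /eqP].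
  by rewrite /E /= big_ord_recr /= addrAC subrr add0r.
case: (loc i (T x)) => c s /= ->; have et : height i a = t.+1 by lia.
have := s0 a ai; rewrite /tower_sum et big_ord_recr /= /E big_ord0 => /eqP.
by rewrite addrC addr_eq0 => /eqP ->; rewrite sub0r.
Qed.

(** The function with value [x a] on the base of the tower of a, and 0 on the
    other floors. *)
Lemma theta_onto i x : exists f, theta f = psi i x /\
  ((forall a, (a < k i)%N -> 0 <= x a) -> forall y, 0 <= val f y).
Proof.
pose F p : int := if p.2 == 0%N then x p.1 else 0.
exists (CZ_of_loc i F); split=> [|x0 y] /=; last first.
  have := loc_tower i y; rewrite /F; case: (loc i y) => a t /= /andP[/= ai _].
  by case: eqP => // _; exact: x0.
rewrite (@thetaE _ i F) //; apply: presents_eq psiP _ _ _ _ => a ai.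
have ha := height_gt0 ai.
by rewrite /tower_sum -(prednK ha) big_ord_recl /= big1 ?addr0.
Qed.

End Theta.

(** [theta] is onto, its kernel is the group of coboundaries, and non-negative
    functions correspond to non-negative vectors of sums along towers. *)
Lemma K0_iso : unital_ordered_group_iso (K0_cone T) Gp (K0_unit T) u.
Proof.
have [theta thetaE] := theta_exists; have thetaB := theta_sub thetaE.
pose phi (q : K0 T) : G := theta (repr q).
have phiE f : phi (K0_class T f) = theta f.
  apply/eqP; rewrite -subr_eq0 -thetaB; apply/eqP/(theta_coboundary thetaE).
  by rewrite Quotient.idealrBE /K0_class reprK.
have classP q : exists f, q = K0_class T f by exists (repr q); rewrite /K0_class reprK.
have phiB : zmod_morphism phi.
  move=> p q; have [f ->] := classP p; have [g ->] := classP q; rewrite !phiE.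
  by rewrite -thetaB -phiE /K0_class raddfB.
pose phim := GRing.isZmodMorphism.Build _ _ phi phiB.
pose Phi : {additive K0 T -> G} := HB.pack phi phim.
have phi_surj g : exists q, phi q = g.
  have [i [x <-]] := presents_surj psiP g; have [f [<- _]] := theta_onto thetaE i x.
  by exists (K0_class T f).
have phi_inj : injective phi.
  move=> p q; have [f ->] := classP p; have [g ->] := classP q; rewrite !phiE => e.
  by apply/eqP; rewrite /K0_class -Quotient.idealrBE; apply: (theta_ker thetaE); rewrite thetaB e subrr.
exists Phi; split.
- exact: inj_surj_bijective.
- apply/seteqP; split=> [_ [_ [f /= f0 <-] <-]|g].
    rewrite -[X in Gp X]/(phi (K0_class T f)) phiE; have [i [F fF]] := loc_factor f.
    rewrite (thetaE _ _ _ fF); apply/(presents_cone psiP); exists i, (tower_sum i F).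
    split=> // a ai; apply: sumr_ge0 => t _.
    have [|x <-] := @loc_surj i (a, t : nat); first by rewrite /tower /= ai /=.
    by rewrite -fF; exact: f0.
  move=> /(presents_cone psiP)[i [x [x0 <-]]]; have [f [<- f0]] := theta_onto thetaE i x.
  by exists (K0_class T f); [exists f => //; exact: f0|exact: phiE].
- rewrite -[LHS]/(phi (K0_class T (CZ1 X))) phiE (thetaE _ 0%N (fun=> 1)) // -psi_unit.
  apply: presents_eq psiP _ _ _ _ => a _.
  by rewrite /tower_sum sumr_const card_ord; exact: (natz (h0 a)).
Qed.

End TowerModel.
End DimensionGroup.

(** * The subshift of a tower system *)

Section TowerSubshift.
Local Open Scope classical_set_scope.

(** Large enough to index both the letters and the floors of level 0. *)
Definition letter_bound : nat := k 0 + \sum_(a < k 0) h0 a.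

Definition tower_alphabet : finType := ('I_letter_bound.+1 * 'I_letter_bound.+1)%type.

Definition decode (l : tower_alphabet) : nat * nat := (val l.1, val l.2).

Definition encode (p : nat * nat) : tower_alphabet := (inord p.1, inord p.2).

Lemma decode_inj : injective decode.
Proof. by case=> a t [a' t'] [/val_inj -> /val_inj ->]. Qed.

Lemma encodeK p : tower 0 p -> decode (encode p) = p.
Proof.
case: p => a t /andP[/= ai ti].
have aW : a < letter_bound.+1 by rewrite ltnS (leq_trans (ltnW ai)) ?leq_addr.
have tW : t < letter_bound.+1.
  rewrite ltnS (leq_trans (ltnW ti)) // (leq_trans _ (leq_addl _ _)) //.
  by rewrite (bigD1 (Ordinal ai)) //= leq_addr.
by rewrite /decode /encode /= !inordK.
Qed.

(** [z] is the reading at level i of the point [y], whose letters are the floors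
    of level 0. *)
Definition coding (i : nat) (z : int -> nat * nat) (y : full_shift tower_alphabet) : Prop :=
  tower_seq i z /\ forall n, decode (y n) = project i (z n).

Definition tower_points : set (full_shift tower_alphabet) :=
  [set y | forall i, exists z, coding i z y].

Lemma coding_shift i z y n : coding i z y ->
  coding i (fun m => z (m + n)%R) (full_shift_pow n y).
Proof. by move=> [zi zy]; split; [exact: tower_seq_shift|move=> m; apply: zy]. Qed.

Lemma coding_descend i z y : coding i.+1 z y -> coding i (descend i \o z) y.
Proof. by move=> [zi zy]; split; [exact: tower_seq_descend|move=> m; rewrite zy]. Qed.

Lemma tower_points_shift y n : tower_points y -> tower_points (full_shift_pow n y).
Proof. by move=> Yy i; have [z zy] := Yy i; eexists; apply: coding_shift zy. Qed.

Hypothesis recP : recognizable_towers.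
Hypothesis propP : proper_towers.

Lemma coding_local i : exists M, forall y y' z z' n, coding i z y -> coding i z' y' ->
  agree M n y y' -> z n = z' n.
Proof.
have [M MP] := project_inj recP i; exists M => y y' z z' n [zi zy] [zi' zy'] ag.
by apply: MP => // m mn; rewrite /= -zy -zy' ag.
Qed.

(** Near n, the reading of a point agreeing with [y] on a large window is the only
    possible one, so these readings glue to one of [y].  Closedness,
    non-emptiness and membership of cluster points all rest on it. *)
Lemma coding_limit i y :
  (forall N, exists y', (exists z, coding i z y') /\ agree N 0%R y y') -> exists z, coding i z y.
Proof.
move=> lim; have [M MP] := coding_local i.
have [w wP] := choice (fun n : int => lim (`|n|%N + M + 2)).
have [z zP] := choice (fun n => (wP n).1).
have agw n m N : `|m|%N + N <= `|n|%N + M + 2 -> agree N m y (w n).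
  by move=> le m' m'm; apply: (wP n).2; lia.
exists (fun n => z n n); split=> n; last first.
  by have [_ <-] := zP n; rewrite (agw n n 0) // ?subrr //; lia.
have [zi _] := zP n; have [tz fz] := zi n; split=> //.
suff -> : z (n + 1)%R (n + 1)%R = z n (n + 1)%R by [].
apply: (MP _ _ _ _ _ (zP _) (zP n)) => m mn.
by rewrite -(agw (n + 1)%R (n + 1)%R M) // -?(agw n (n + 1)%R M) //; lia.
Qed.

Lemma tower_points_closed : closed tower_points.
Proof.
move=> y cl i; apply: coding_limit => N.
have [y' [Yy' ag]] := cl _ (nbhs_cylinder y N).
by exists y'; split=> //; exact: Yy'.
Qed.

Lemma tower_points_invariant :
  @full_shift_map tower_alphabet @` tower_points = tower_points.
Proof.
apply/seteqP; split=> [_ [y Yy <-]|y Yy]; first exact: (tower_points_shift 1%R Yy).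
exists (full_shift_pow (-1)%R y); first exact: tower_points_shift.
by apply/funext => n; rewrite /full_shift_map /full_shift_pow; congr y; lia.
Qed.

Definition tower_subshift : subshift tower_alphabet :=
  Subshift tower_points_closed tower_points_invariant.

Definition subshift_point y (Yy : tower_points y) : set_type tower_subshift :=
  exist (fun y' => y' \in subshift_set tower_subshift) y (mem_set Yy).

(** The tower of letter 0 repeated periodically. *)
Lemma tower_seq_exists i : exists z, tower_seq i z.
Proof.
have hp := height_gt0 (k_gt0 i); set h := height i 0 in hp.
exists (fun n => (0, `|(n %% h)%Z|%N)) => n; rewrite /tower /follows /= k_gt0 -/h.
have hn0 : (h%:Z != 0)%R by lia.
have := modz_ge0 n hn0; have := ltz_mod n hn0; have := modz_ge0 (n + 1)%R hn0.
have := ltz_mod (n + 1)%R hn0.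
have : ((n + 1) %% h = ((n %% h)%Z + 1) %% h)%Z by rewrite modzDml.
set a := (n %% h)%Z; set b := ((n + 1) %% h)%Z => e lb b0 la a0.
split; first by lia.
case: ifP => lt.
  by rewrite e modz_small ?xpair_eqE ?eqxx /=; lia.
have ea : (a + 1 = h)%R by lia.
by rewrite e ea modzz.
Qed.

Lemma coding_below i n y : (exists z, coding (n + i) z y) -> exists z, coding i z y.
Proof.
elim: n => //= n IH [z]; rewrite addSn => /coding_descend zy.
by apply: IH; exists (descend (n + i) \o z).
Qed.

(** A cluster point of the periodic readings of all levels has readings at all
    levels. *)
Lemma tower_points_nonempty : tower_points !=set0.
Proof.
have [z zP] := choice tower_seq_exists.
pose s i : full_shift tower_alphabet := fun n => encode (project i (z i n)).
have sP i : coding i (z i) (s i).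
  by split=> // n; rewrite encodeK //; apply: tower_project; have [] := zP i n.
have [y yP] := full_shift_cluster s; exists y => i; apply: coding_limit => N.
have [j ij ag] := yP N i; exists (s j); split=> //.
apply: (@coding_below i (j - i)); rewrite subnK //; by exists (z j).
Qed.

Lemma coding_of_point i (x : set_type tower_subshift) : exists z, coding i z (val x).
Proof. by have /set_mem := valP x; apply. Qed.

(** By recognizability the floor of a point at each level is well defined. *)
Lemma locator_exists : exists loc : nat -> set_type tower_subshift -> nat * nat,
  forall i x z, coding i z (val x) -> loc i x = z 0%R.
Proof.
have [loc locP] := choice (fun ix : nat * set_type tower_subshift => coding_of_point ix.1 ix.2).
exists (fun i x => loc (i, x) 0%R) => i x z zx; have [M MP] := coding_local i.
by apply: (MP _ _ _ _ _ (locP (i, x)) zx).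
Qed.

Section Locator.
Variable loc : nat -> set_type tower_subshift -> nat * nat.
Hypothesis locE : forall i x z, coding i z (val x) -> loc i x = z 0%R.

Lemma locator_tower i x : tower i (loc i x).
Proof. by have [z zx] := coding_of_point i x; rewrite (locE zx); have [] := zx.1 0%R. Qed.

Lemma locator_follows i x : follows i (loc i x) (loc i (subshift_map tower_subshift x)).
Proof.
have [z zx] := coding_of_point i x; have zx1 := coding_shift 1%R zx.
by rewrite (locE zx) (@locE i (subshift_map _ x) _ zx1); have [] := zx.1 0%R.
Qed.

Lemma locator_descend i x : loc i x = descend i (loc i.+1 x).
Proof.
by have [z zx] := coding_of_point i.+1 x; rewrite (locE zx) (locE (coding_descend zx)).
Qed.

Lemma coding_occurs i p y : tower_points y -> tower i p -> exists z n, coding i z y /\ z n = p.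
Proof.
move=> Yy ip; have [z zy] := Yy i.+1; have [n zn] := tower_seq_occurs zy.1 ip.
by exists (descend i \o z), n; split=> //; exact: coding_descend.
Qed.

Lemma locator_surj i p : tower i p -> exists x, loc i x = p.
Proof.
have [y Yy] := tower_points_nonempty => ip; have [z [n [zy <-]]] := coding_occurs Yy ip.
exists (subshift_point (tower_points_shift n Yy)); have zn := coding_shift n zy.
by rewrite (@locE i (subshift_point _) _ zn) add0r.
Qed.

Lemma nbhs_subshift_cylinder (x : set_type tower_subshift) N :
  nbhs x [set x' : set_type tower_subshift | agree N 0%R (val x) (val x')].
Proof.
have c : continuous (val : set_type tower_subshift -> full_shift tower_alphabet).
  exact: initial_continuous.
exact: c (nbhs_cylinder (val x) N).
Qed.

Lemma locator_continuous i (F : nat * nat -> int) :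
  (fun x => F (loc i x)) \in @Defs.continuousZ (set_type tower_subshift).
Proof.
apply/continuousZP => x; apply/discrete_cvg.
  by apply: fmap_filter; exact: nbhs_filter.
change (nbhs x [set x' | F (loc i x') = F (loc i x)]).
have [M MP] := coding_local i; have := nbhs_subshift_cylinder x M.
apply: (@filterS _ _ (nbhs_filter x)) => x' /= ag; have [z zx] := coding_of_point i x.
have [z' zx'] := coding_of_point i x'.
by rewrite (locE zx) (locE zx') (MP _ _ _ _ _ zx zx' ag).
Qed.

Lemma locator_agree N : exists i, forall y y' z z' n, coding i z y -> coding i z' y' ->
  z n = z' n -> agree N n y y'.
Proof.
have [i iP] := propP N; exists i => y y' z z' n [zi zy] [zi' zy'] zn m mn.
by apply: decode_inj; rewrite zy zy'; apply: (iP z z' n).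
Qed.

Lemma locator_below i j x x' : j <= i -> loc i x = loc i x' -> loc j x = loc j x'.
Proof.
move=> ji; rewrite -(subnK ji); elim: (i - j) => //= n IH e.
by apply: IH; rewrite !(locator_descend (n + j)) e.
Qed.

(** Otherwise there are, for each i, two points with the same floor at level i and
    different values of f.  Near a cluster point both members of such a pair agree
    with it on a long window, by properness, whereas f is locally constant there. *)
Lemma locator_factor (f : CZ (set_type tower_subshift)) :
  exists i F, forall x, val f x = F (loc i x).
Proof.
have [j jP] : exists i, forall x x', loc i x = loc i x' -> val f x = val f x'.
  apply: contrapT => /forallNP no.
  have /choice[w wP] : forall i, exists xx : set_type tower_subshift * set_type tower_subshift,
      loc i xx.1 = loc i xx.2 /\ val f xx.1 <> val f xx.2.
    move=> i; apply: contrapT => /forallNP no'; apply: (no i) => x x' e.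
    by apply: contrapT => ne; apply: (no' (x, x')).
  (* the cluster point is taken on the first members of the pairs *)
  have [y yP] := full_shift_cluster (fun i => val (w i).1).
  have Yy : tower_points y.
    move=> i; apply: coding_limit => N; have [j _ ag] := yP N 0.
    by exists (val (w j).1); split=> //; exact: coding_of_point.
  pose x := subshift_point Yy.
  have /continuousZP/(_ x) fx := valP f.
  have {fx} /discrete_cvg fx := fx.
  have {}fx : nbhs x [set x' | val f x' = val f x].
    by apply: fx; apply: fmap_filter; exact: nbhs_filter.
  have [_ [[Q oQ <-] Qy sub]] := fx.
  have [N QN] : exists N, forall y', agree N 0%R y y' -> Q y'.
    by apply: cylinder_nbhs; apply: open_nbhs_nbhs.
  have [j jP] := locator_agree N; have [i ij ag] := yP N j.
  have [ei []] := wP i; have ej := locator_below ij ei.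
  have fQ x' : agree N 0%R y (val x') -> val f x' = val f x by move=> ?; apply: sub; apply: QN.
  have [z zx] := coding_of_point j (w i).1; have [z' zx'] := coding_of_point j (w i).2.
  rewrite (locE zx) (locE zx') in ej; have ag' := jP _ _ _ _ _ zx zx' ej.
  by rewrite !fQ // => m mN; rewrite ag // ag'.
have /choice[F FP] : forall p, exists v, forall x, loc j x = p -> val f x = v.
  move=> p; have [[x xp]|no] := pselect (exists x, loc j x = p).
    by exists (val f x) => x' x'p; apply: jP; rewrite xp.
  by exists 0%R => x xp; case: no; exists x.
by exists j, F => x; apply: FP.
Qed.

Lemma locator_K0 (G : zmodType) (Gp : set G) (u : G) psi :
  presents k B Gp psi -> psi 0 (fun a => (h0 a)%:Z)%R = u ->
  unital_ordered_group_iso (K0_cone (subshift_map tower_subshift)) Gp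
    (K0_unit (subshift_map tower_subshift)) u.
Proof.
apply: K0_iso; [exact: locator_tower|exact: locator_follows|exact: locator_descend|
  exact: locator_surj|exact: locator_factor|exact: locator_continuous].
Qed.

End Locator.

Lemma tower_subshift_K0 (G : zmodType) (Gp : set G) (u : G) psi :
  presents k B Gp psi -> psi 0 (fun a => (h0 a)%:Z)%R = u ->
  unital_ordered_group_iso (K0_cone (subshift_map tower_subshift)) Gp
    (K0_unit (subshift_map tower_subshift)) u.
Proof. by move=> psiP psiu; have [loc locE] := locator_exists; exact: (locator_K0 locE psiP psiu). Qed.

(** A window of one point is determined by its floor at a deep level, and every
    floor is visited by every orbit. *)
Lemma tower_subshift_minimal : minimal_subshift tower_subshift.
Proof.
move=> y Yy y' Yy' U /cylinder_nbhs[N UN]; have [i iP] := locator_agree N.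
have [z' zy'] := Yy' i; have [t0 _] := zy'.1 0%R.
have [z [n [zy zn]]] := coding_occurs Yy t0.
exists (full_shift_pow n y); split; first by exists n.
by apply: UN; apply: (iP _ _ _ _ _ zy' (coding_shift n zy)); rewrite add0r zn.
Qed.

(** * Complexity of the tower subshift *)

Lemma complexity_le_codes (C : finType) (code : C -> nat -> nat * nat) n :
  (forall y, tower_points y -> forall m, exists c, forall r, r < n ->
     decode (y (m + r%:Z)%R) = code c r) ->
  complexity tower_subshift n <= #|C|.
Proof.
move=> codeP; pose word c : n.-tuple tower_alphabet := [tuple encode (code c r) | r < n].
apply: leq_trans (leq_imset_card word C); apply: subset_leq_card.
apply/fintype.subsetP => w; rewrite inE => /asboolP[y [Yy [m wy]]].
have [c cP] := codeP y Yy m; apply/imsetP; exists c => //; apply: eq_from_tnth => r.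
rewrite tnth_mktuple -cP // wy; apply: decode_inj; rewrite encodeK //.
by have [z [zi ->]] := Yy 0; have [] := zi (m + (r : nat)%:Z)%R.
Qed.

(** A window is determined by the floor where it starts if it stays in a run, and
    by the letter and the position of the change of run otherwise. *)
Lemma tower_complexity i n :
  (forall b a, b < k i.+1 -> a < k i -> n <= B i b a) ->
  complexity tower_subshift n <= k i * n + \sum_(a < k i) height i a.
Proof.
move=> leB; pose C : finType := ('I_(k i) * 'I_n + {a : 'I_(k i) & 'I_(height i a)})%type.
have -> : k i * n + \sum_(a < k i) height i a = #|C|.
  by rewrite card_sum card_prod !card_ord card_tagged sumnE big_map big_enum; congr (_ + _);
    apply: eq_bigr => a _; rewrite card_ord.
pose code (c : C) : nat -> nat * nat := fun r => project i (match c with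
  | inl ae => cut_word i ae.1 ae.2 r
  | inr at_ => run_word i (tag at_) (tagged at_) r end).
apply: (complexity_le_codes (code := code)) => y Yy m.
have [z [zi zy]] := Yy i.+1; case: (window_run_or_cut m zi leB).
  move=> [a [t [/andP[/= ai ti] zr]]].
  exists (inr (Tagged (fun a : 'I_(k i) => 'I_(height i a))
    (Ordinal ti : 'I_(height i (Ordinal ai))))) => r rn.
  by rewrite zy /= zr.
by move=> [a [e [ai en zr]]]; exists (inl (Ordinal ai, Ordinal en)) => r rn; rewrite zy /= zr.
Qed.

Lemma tower_complexity_cyclic n : k 0 = 1 -> complexity tower_subshift n <= h0 0.
Proof.
move=> k01; rewrite -[leqRHS](card_ord (h0 0)).
apply: (complexity_le_codes (code := fun t : 'I_(h0 0) => run_word 0 0 t)) => y Yy m.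
have [z [zi zy]] := Yy 0; have [] := zi m; case e : (z m) => [a t] /andP[/=]; rewrite k01.
case: a e => // e _ th _; exists (Ordinal th) => r _; rewrite zy /run_word /=.
elim: r => [|r IH]; first by rewrite addr0 addn0 e modn_small.
have [_] := zi (m + r%:Z)%R; have [/andP[+ _] _] := zi (m + r.+1%:Z)%R.
have -> : (m + r%:Z + 1 = m + r.+1%:Z)%R by lia.
rewrite IH k01 /follows /=; case: (z _) => -[|//] s /= _.
case: ifP => lt.
  by move=> /eqP[->]; rewrite addnS modnS_small.
by move=> /eqP ->; rewrite addnS modnS_wrap ?lt ?h0_gt0 ?k01.
Qed.

End TowerSubshift.

(** * One-letter systems *)

Section Cyclic.
Hypothesis k1 : forall i, k i = 1.
Hypothesis B1 : forall i, B i 0 0 = 1.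

Lemma cyclic_height i : height i 0 = h0 0.
Proof. by elim: i => // i IH; rewrite -offset_height k1 offsetS offset0 B1 mul1n. Qed.

Lemma cyclic_descend i p : tower i.+1 p -> descend i p = p.
Proof.
case: p => b s /andP[/= bi si]; rewrite k1 ltnS leqn0 in bi; move/eqP: bi si => -> si.
rewrite cyclic_height in si.
by rewrite descend0 ?k1 // ?B1 ?mul1n cyclic_height // modn_small.
Qed.

Lemma cyclic_recognizable : recognizable_towers.
Proof.
move=> i; exists 0 => z z' n zi zi' ag; have := ag n; rewrite subrr /= => /(_ isT).
by rewrite !cyclic_descend //; [have [] := zi' n|have [] := zi n].
Qed.

(** With a single tower a floor determines the whole reading. *)
Lemma cyclic_proper : proper_towers.
Proof.
move=> N; exists 0 => z z' n zi zi' e m _ /=.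
have fst0 y q : tower_seq 0 y -> (y q).1 = 0.
  by move=> yi; have [/andP[+ _] _] := yi q; rewrite k1; case: (y q).1.
have fwd q : z q = z' q -> z (q + 1)%R = z' (q + 1)%R.
  move=> eq; have [_] := zi q; have [_] := zi' q; rewrite /follows -eq.
  case: ifP => _ /eqP e1 /eqP e2; first by rewrite e1 e2.
  by rewrite [z _]surjective_pairing [z' _ in RHS]surjective_pairing e1 e2 !fst0.
have bwd q : z q = z' q -> z (q - 1)%R = z' (q - 1)%R.
  case e0 : (z q) => [a [|t]] eq; last first.
    by rewrite (tower_seqP zi e0) (tower_seqP zi' (esym eq)).
  have := tower_seq_start zi e0; have := tower_seq_start zi' (esym eq); rewrite !fst0 //.
  move=> e1 e2; rewrite [z _]surjective_pairing [z' _ in RHS]surjective_pairing.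
  by rewrite e1 e2 !fst0.
have [r [->|->]] : exists r : nat, m = (n + r%:Z)%R \/ m = (n - r%:Z)%R.
  by exists `|m - n|%N; lia.
- elim: r => [|r IH]; first by rewrite addr0.
  by have := fwd _ IH; have -> : (n + r%:Z + 1 = n + r.+1%:Z)%R by lia.
- elim: r => [|r IH]; first by rewrite subr0.
  by have := bwd _ IH; have -> : (n - r%:Z - 1 = n - r.+1%:Z)%R by lia.
Qed.

End Cyclic.

End Towers.

(** * Positive combinations of few large vectors *)

Section Generators.
Variables (d K M : nat).
Hypotheses (d_gt0 : 0 < d) (K_gt0 : 0 < K) (M_gt0 : 0 < M).

(** For c = 2j or 2j + 1: the vector with all coordinates K, plus
    K * M + c at coordinate j.  Since the two vectors attached to j differ by the
    unit vector of j, they reach all residues; M makes their cone wide; and the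
    term c makes the vectors pairwise distinct in a way that survives composition
    (see [generator_rows_inj]). *)
Definition generator (c i : nat) : nat := K + (i == c./2) * (K * M + c).

Lemma sum_double (V : nmodType) (f : nat -> V) n :
  (\sum_(c < n.*2) f c = \sum_(j < n) (f j.*2 + f j.*2.+1))%R.
Proof.
by elim: n => [|n IH]; rewrite ?big_ord0 // doubleS !big_ord_recr /= IH addrA.
Qed.

Lemma sum_generator (s : nat -> nat) i : i < d ->
  \sum_(c < d.*2) s c * generator c i =
  K * (\sum_(c < d.*2) s c) + (K * M + i.*2) * (s i.*2 + s i.*2.+1) + s i.*2.+1.
Proof.
move=> id; rewrite big_distrr /=.
under eq_bigr do rewrite /generator mulnDr (mulnC _ K).
rewrite big_split /= -addnA; congr (_ + _).
rewrite (sum_double (fun c => s c * ((i == c./2) * (K * M + c)))).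
rewrite (bigD1 (Ordinal id)) //= big1 => [|j ji]; last first.
  rewrite -[(_ + _)%R]/(_ + _) uphalf_double doubleK.
  by rewrite eq_sym -[_ == _]/(j == Ordinal id) (negbTE ji) !mul0n !muln0.
rewrite -[(_ + _ + 0)%R]/(_ + _ + 0) uphalf_double doubleK eqxx; lia.
Qed.

Definition generator_bound : nat :=
  let v := K * M + d.*2 in (v * (v.+1 * d.+1) + 1).*2.

(** Let T be the number of generators to be used.  They contribute K * T to each
    coordinate, and the rest y = x i - K * T must be a sum of n numbers equal to v
    or v + 1, where v = K * M + 2i, with n approximately y / v.  The sum of these n
    over i decreases with T, so that it crosses T; the crossing is missed by at
    most d, a defect which one of the n can absorb because n v + r with any
    0 < r < n is reachable.  The cone condition ensures that T is small enough
    for y to remain large. *)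
Lemma generators_span (x : nat -> nat) :
  (forall i, i < d -> (\sum_(j < d) x j).*2 <= M * x i) ->
  (forall i, i < d -> generator_bound <= x i) ->
  exists s : nat -> nat, (forall c, c < d.*2 -> 0 < s c) /\
    forall i, i < d -> x i = \sum_(c < d.*2) s c * generator c i.
Proof.
move=> cone large; pose v j := K * M + j.*2.
have v0 j : 0 < v j by rewrite /v addn_gt0 muln_gt0 K_gt0 M_gt0.
pose hi T j := (x j - K * T - 1) %/ v j.
pose P T := T <= \sum_(j < d) hi T j.
have P0 : exists T, P T by exists 0.
have Ple T i : i < d -> P T -> (K * T).*2 <= x i.
  move=> id PT; rewrite -(leq_pmul2l M_gt0); apply: leq_trans (cone i id).
  rewrite -doubleMr leq_double mulnA [M * K]mulnC mulnC.
  apply: leq_trans (leq_mul PT (leqnn _)) _; rewrite big_distrl /=.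
  apply: leq_sum => j _; rewrite /hi.
  apply: leq_trans (leq_trans (leq_mul (leqnn _) (leq_addr j.*2 _)) (leq_divM _ _)) _.
  by rewrite -subnDA leq_subr.
have Pb T : P T -> T <= x 0.
  move=> /(Ple T 0 d_gt0); apply: leq_trans.
  by rewrite -mul2n mulnA leq_pmull ?muln_gt0.
(* the last T for which the quotients still sum to at least T *)
have [T PT Tmax] := ex_maxnP P0 Pb.
have yl i : i < d -> v i * ((v i).+1 * d.+1) + 1 <= x i - K * T.
  move=> id; have := Ple T i id PT; have := large i id; rewrite /generator_bound.
  have : v i * ((v i).+1 * d.+1) <= (K * M + d.*2) * ((K * M + d.*2).+1 * d.+1).
    by rewrite !leq_mul // /v; lia.
  set a := v i * _; set b := (K * M + d.*2) * _; lia.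
have hi_large i : i < d -> (v i).+1 * d.+1 <= hi T i.
  by move=> id; rewrite /hi leq_divRL // mulnC; have := yl i id; lia.
have sum_hi : \sum_(j < d) hi T j <= T + d.
  have : ~~ P T.+1 by apply/negP => /Tmax; rewrite ltnn.
  rewrite /P -ltnNge ltnS => lt; rewrite addnC -leq_subLR.
  apply: leq_trans lt; rewrite leq_subLR.
  have -> : d + \sum_(j < d) hi T.+1 j = \sum_(j < d) (1 + hi T.+1 j).
    by rewrite big_split /= sum1_card card_ord.
  apply: leq_sum => j _; rewrite /hi mulnS.
  have -> : x j - (K + K * T) - 1 = x j - K * T - 1 - K by lia.
  have KM : K <= v j by rewrite /v (leq_trans _ (leq_addr _ _)) // leq_pmulr.
  move: (x j - K * T - 1) => Z; case: (ltnP Z (v j)) => Zv; first by rewrite divn_small.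
  rewrite -{1}(subnK Zv) divnDr // divnn v0 addnC leq_add2l.
  by apply: leq_div2r; exact: leq_sub2l.
(* the whole defect is put on coordinate 0 *)
pose e j := if j == 0 then \sum_(j < d) hi T j - T else 0.
pose n j := hi T j - e j.
have ed j : e j <= d by rewrite /e; case: eqP => // _; lia.
have sum_n : \sum_(j < d) n j = T.
  have en j : j < d -> n j + e j = hi T j.
    move=> jd; rewrite subnK // (leq_trans (ed j)) // (leq_trans _ (hi_large j jd)) //.
    by rewrite mulSn (leq_trans (leqnSn d)) ?leq_addr.
  have : \sum_(j < d) n j + \sum_(j < d) e j = \sum_(j < d) hi T j.
    by rewrite -big_split; apply: eq_bigr => j _; exact: en.
  rewrite (bigD1 (Ordinal d_gt0) (F := fun j => e j)) //= [X in e 0 + X]big1 ?addn0.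
    rewrite /e /=; move: PT; rewrite /P.
    by move: (\sum_(j < d) n j) (\sum_(j < d) hi T j) => a b; lia.
  by move=> j j0; rewrite /e -[_ == 0]/(j == Ordinal d_gt0) (negbTE j0).
have y_ge j : j < d -> v j * n j + 1 <= x j - K * T.
  move=> jd; have le1 : v j * n j <= v j * hi T j by rewrite leq_mul2l leq_subr orbT.
  have := leq_divM (x j - K * T - 1) (v j); rewrite -/(hi T j) mulnC; have := yl j jd; lia.
have y_le j : j < d -> x j - K * T + 1 <= (v j).+1 * n j.
  move=> jd; have := ltn_ceil (x j - K * T - 1) (v0 j); rewrite -/(hi T j).
  have := hi_large j jd; have := ed j; rewrite /n; move: (e j) (hi T j) (v j) => a b c ad.
  move: (x j - K * T) => Z le1; rewrite mulnBr !mulSn mulnS in le1 *.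
  have : c.+1 * a <= c.+1 * d by rewrite leq_mul2l ad orbT.
  rewrite !mulSn [b * c]mulnC; lia.
pose r j := x j - K * T - v j * n j.
pose s c := if odd c then r c./2 else n c./2 - r c./2.
have s0 j : s j.*2 = n j - r j by rewrite /s odd_double doubleK.
have s1 j : s j.*2.+1 = r j by rewrite /s /= odd_double /= uphalf_double.
exists s; split=> [c cd|i id].
  have jd : c./2 < d by lia.
  have := y_ge _ jd; have := y_le _ jd; rewrite mulSn /s /r; case: ifP => _; lia.
rewrite (sum_generator s) // (sum_double s) s0 s1.
have -> : (\sum_(j < d) (s j.*2 + s j.*2.+1))%R = T.
  rewrite -[RHS]sum_n; apply: eq_bigr => j _; rewrite s0 s1 -[(_ + _)%R]/(_ + _).
  by have := y_le _ (ltn_ord j); rewrite mulSn /r => h; rewrite subnK //; lia.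
have := y_ge _ id; have := y_le _ id; have := Ple T i id PT.
rewrite mulSn -/(v i) /r; set a := v i * n i => h1 h2 h3.
rewrite subnK; last lia.
by rewrite -/a; lia.
Qed.

End Generators.

(** * Growth of telescoped matrices *)

Section Telescoping.
Variables (d : nat -> nat) (a : nat -> nat -> nat -> nat).
Hypothesis d_gt0 : forall i, 0 < d i.
Hypothesis a_gt0 : forall i b j, b < d i.+1 -> j < d i -> 0 < a i b j.

Local Notation entry := (entry d a).

Definition entries_ge (L n i : nat) : Prop :=
  forall b j, b < d (n + i) -> j < d i -> L <= entry n i b j.

(** One term of each sum of products suffices. *)
Lemma entries_ge_mul L1 L2 n m i : entries_ge L1 n (m + i) -> entries_ge L2 m i ->
  entries_ge (L1 * L2) (n + m) i.
Proof.
move=> ge1 ge2 b j bi ji; rewrite entry_add // (bigD1 (Ordinal (d_gt0 (m + i)))) //=.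
rewrite -addnA in bi; apply: leq_trans (leq_addr _ _).
by rewrite leq_mul ?ge1 ?ge2.
Qed.

Lemma entry1 i b j : b < d i.+1 -> entry 1 i b j = a i b j.
Proof.
move=> bi /=; rewrite (bigD1 (Ordinal bi)) //= eqxx mul1n big1 ?addn0 // => c cb.
by rewrite eq_sym -[_ == _]/(c == Ordinal bi) (negbTE cb).
Qed.

Lemma entries_ge1 n i : entries_ge 1 n.+1 i.
Proof.
elim: n i => [|n IH] i; first by move=> b j bi ji; rewrite entry1 ?a_gt0.
by have := entries_ge_mul (IH (1 + i)) (_ : entries_ge 1 1 i); rewrite addn1; apply;
  move=> b j bi ji; rewrite entry1 ?a_gt0.
Qed.

Definition expanding : Prop := forall L m, exists n, entries_ge L n.+1 m.

Lemma entry2 i b j : b < d i.+2 ->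
  entry 2 i b j = \sum_(c < d i.+1) a i.+1 b c * a i c j.
Proof. by move=> bi; apply: eq_bigr => c _; rewrite -/(entry 1 i.+1 b c) entry1. Qed.

(** If an entry of the product of two consecutive positive matrices is 1, then the
    intermediate dimension is 1, and so are the two entries it is made of.  If this
    happens at all large levels, everything is eventually 1; otherwise infinitely
    many of these products have entries at least 2, and they multiply. *)
Lemma expanding_or_cyclic :
  expanding \/ exists m1, forall m, m1 <= m -> d m = 1 /\ a m 0 0 = 1.
Proof.
have [good|/existsNP[m0 /forallNP no]] :=
    pselect (forall m, exists m', m <= m' /\ entries_ge 2 2 m').
  left; elim=> [|L IH] m; first by exists 0.
  have [n nL] := IH m; have [m' [lt gem']] := good (n.+1 + m).+1.
  have {lt} [q em] : exists q, m' = q.+1 + (n.+1 + m) by exists (m' - (n.+1 + m)).-1; lia.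
  subst m'; have := entries_ge_mul (@entries_ge1 q _) nL; rewrite mul1n => ge1.
  case: L nL ge1 {IH} => [|L] nL ge1; first by exists n; exact: entries_ge1.
  rewrite addnA in gem'; have ge2 := entries_ge_mul gem' ge1.
  exists (2 + (q.+1 + n.+1)).-1 => b j bi ji.
  by apply: leq_trans (ge2 b j bi ji); lia.
right; exists m0.+1.
have step m : m0 <= m -> d m.+1 = 1 /\ exists b j,
    [/\ b < d m.+2, j < d m, a m.+1 b 0 = 1 & a m 0 j = 1].
  move=> le; have /existsNP[b /existsNP[j /not_implyP[bi /not_implyP[ji /negP]]]] :
    ~ entries_ge 2 2 m by move=> ge; apply: (no m).
  rewrite entry2 // -ltnNge ltnS => le1.
  have all1 c : c < d m.+1 -> 0 < a m.+1 b c * a m c j by move=> ci; rewrite muln_gt0 !a_gt0.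
  have d1 : d m.+1 = 1.
    apply/eqP; rewrite eqn_leq d_gt0 andbT; apply: leq_trans le1.
    rewrite -[leqLHS]card_ord -sum1_card; apply: leq_sum => c _; exact: all1.
  split=> //; exists b, j; have := all1 0 (d_gt0 _).
  rewrite muln_gt0 => /andP[p1 p2]; move: le1; rewrite (bigD1 (Ordinal (d_gt0 m.+1))) //=.
  move=> le1; have {}le1 : a m.+1 b 0 * a m 0 j <= 1 by apply: leq_trans (leq_addr _ _) le1.
  by split=> //; nia.
case=> // m le; have [d1 [b [_ [bi _ ab _]]]] := step m le.
split=> //; have [d2 [_ [j [_ ji _ aj]]]] := step m.+1 (leqW le).
by rewrite d1 in ji; case: j ji aj.
Qed.

(** The rows of the telescoped matrix are combinations of the rows of its first
    matrix, so the ratios of their coordinates are bounded independently of the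
    length of the telescoping.  Therefore M depends on m only and K is free. *)
Lemma generators_factor m : expanding -> exists2 M, 0 < M & forall K, 0 < K ->
  exists n C, [/\ 0 < n,
    forall b c, b < d (n + m) -> c < (d m).*2 -> 0 < C b c &
    forall b j, b < d (n + m) -> j < d m ->
      entry n m b j = \sum_(c < (d m).*2) C b c * generator K M c j].
Proof.
(* S bounds all row sums of the first matrix, hence all ratios within a row *)
move=> expand; pose S := \sum_(c < d m.+1) \sum_(j < d m) a m c j.
have S_ge c : c < d m.+1 -> \sum_(j < d m) a m c j <= S.
  by move=> ci; rewrite /S [leqRHS](bigD1 (Ordinal ci)) //= leq_addr.
have S0 : 0 < S.
  apply: leq_trans (S_ge 0 (d_gt0 _)); rewrite (bigD1 (Ordinal (d_gt0 m))) //=.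
  by rewrite addn_gt0 a_gt0.
exists S.*2; first by rewrite double_gt0.
move=> K K0; have M0 : 0 < S.*2 by rewrite double_gt0.
have [n ge] := expand (generator_bound (d m) K S.*2) m.
have /choice[C CP] : forall b, exists s : nat -> nat, b < d (n.+1 + m) ->
    (forall c, c < (d m).*2 -> 0 < s c) /\
    forall j, j < d m -> entry n.+1 m b j = \sum_(c < (d m).*2) s c * generator K S.*2 c j.
  move=> b; case: (boolP (b < d (n.+1 + m))) => bi; last by exists id.
  have [j jd|j jd|s sP] := generators_span (x := entry n.+1 m b) (d_gt0 m) K0 M0.
  - rewrite -doubleMl leq_double /= exchange_big /=.
    have le c : c < d m.+1 -> \sum_(j < d m) entry n m.+1 b c * a m c j <= S * (entry n m.+1 b c * a m c j).
      move=> ci; rewrite -big_distrr /= mulnCA leq_mul2l; apply/orP; right.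
      by apply: leq_trans (S_ge c ci) _; rewrite leq_pmulr ?a_gt0.
    by rewrite big_distrr; apply: leq_sum => c _; exact: le.
  - exact: ge.
  - by exists s.
exists n.+1, C; split=> // b c bi; [exact: (CP b bi).1|exact: (CP b bi).2].
Qed.

End Telescoping.

(** * Stages with slowly growing alphabets *)

Section Stages.
Local Open Scope ring_scope.
Variables (d : nat -> nat) (a : nat -> nat -> nat -> nat).
Hypothesis d_gt0 : forall i, (0 < d i)%N.
Hypothesis a_gt0 : forall i b j, (b < d i.+1)%N -> (j < d i)%N -> (0 < a i b j)%N.
Hypothesis expand : expanding d a.
Variables (R : realType) (p : nat -> R).
Hypothesis p_superlinear : forall E : nat, exists N, forall n, (N <= n)%N -> (E * n)%:R <= p n.

Definition apply_mx (k : nat) (C : nat -> nat -> nat) (x : nat -> int) : nat -> int :=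
  fun b => \sum_(c < k) x c *+ C b c.

Lemma apply_mx_mul k k' C D x b :
  apply_mx k' D (apply_mx k C x) b =
  apply_mx k (fun b c => \sum_(j < k') D b j * C j c)%N x b.
Proof.
rewrite /apply_mx; under eq_bigr do rewrite -sumrMnl.
rewrite exchange_big; apply: eq_bigr => c _ /=; rewrite -sumrMnr.
by apply: eq_bigr => j _; rewrite -mulrnA mulnC.
Qed.

Lemma eq_apply_mx k C x y b : (forall c, (c < k)%N -> x c = y c) ->
  apply_mx k C x b = apply_mx k C y b.
Proof. by move=> xy; apply: eq_bigr => c _; rewrite xy. Qed.

Lemma apply_mx_nat k C (h : nat -> nat) b :
  apply_mx k C (fun c => (h c)%:Z) b = (\sum_(c < k) C b c * h c)%N%:Z.
Proof.
rewrite -[RHS]natz raddf_sum /=; apply: eq_bigr => c _.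
by rewrite -[(h c)%:Z]natz -mulrnA mulnC.
Qed.

(** A stage of the construction: [coord] maps Z^letters to the original group of
    index [level], [gens] maps the original group of the preceding stage to
    Z^letters, and the new presentation is made of the groups Z^letters. *)
Record stage := Stage {
  level : nat;
  letters : nat;
  coord : nat -> nat -> nat;
  heights : nat -> nat;
  threshold : nat;
  gens : nat -> nat -> nat }.

Definition stage_mx (s s' : stage) (c b : nat) : nat :=
  (\sum_(j < d (level s)) gens s' c j * coord s j b)%N.

Definition admissible (s : stage) : Prop := (1 < letters s)%N /\
  forall b c, (b < d (level s))%N -> (c < letters s)%N -> (0 < coord s b c)%N.

(** The composition of [gens] and [coord] is the original telescoped matrix;
    [refines_cost] bounds the right-hand side of [tower_complexity] for all lengths
    beyond the threshold, itself a lower bound of the entries of the new matrix. *)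
Record refines (i : nat) (s s' : stage) : Prop := Refines {
  refines_level : exists n, [/\ (0 < n)%N, level s' = (n + level s)%N &
    forall y b, (b < d (level s'))%N ->
      apply_mx (letters s') (coord s') (apply_mx (d (level s)) (gens s') y) b =
      push d a n (level s) y b];
  refines_heights : forall c,
    heights s' c = (\sum_(b < letters s) stage_mx s s' c b * heights s b)%N;
  refines_inj : forall c c', (c < letters s')%N -> (c' < letters s')%N ->
    (forall b, (b < letters s)%N -> stage_mx s s' c b = stage_mx s s' c' b) -> c = c';
  refines_large : forall c b, (c < letters s')%N -> (b < letters s)%N ->
    (threshold s' <= stage_mx s s' c b)%N;
  refines_threshold : (threshold s < threshold s')%N;
  refines_cost : forall n, (threshold s' <= n)%N ->
    (i.+1 * (letters s' * n + \sum_(c < letters s') heights s' c))%:R <= p n }.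

Lemma generators_push m : exists2 M, (0 < M)%N & forall K, (0 < K)%N ->
  exists n C, [/\ (0 < n)%N,
    forall b c, (b < d (n + m))%N -> (c < (d m).*2)%N -> (0 < C b c)%N &
    forall y b, (b < d (n + m))%N ->
      apply_mx (d m).*2 C (apply_mx (d m) (generator K M) y) b = push d a n m y b].
Proof.
have [M M0 MP] := generators_factor d_gt0 a_gt0 m expand; exists M => // K K0.
have [n [C [n0 C0 CP]]] := MP K K0; exists n, C; split=> // y b bm.
by rewrite apply_mx_mul push_entry //; apply: eq_bigr => j _; rewrite CP.
Qed.

Lemma sum_generator_row dm K M c (C : nat -> nat) : (c < dm.*2)%N ->
  (\sum_(j < dm) generator K M c j * C j =
   K * \sum_(j < dm) C j + (K * M + c) * C c./2)%N.
Proof.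
move=> cd; have jd : (c./2 < dm)%N by lia.
under eq_bigr do rewrite /generator mulnDl.
rewrite big_split /= -big_distrr; congr (_ + _)%N.
rewrite (bigD1 (Ordinal jd)) //= eqxx mul1n big1 ?addn0 // => j jc.
by rewrite -[_ == _]/(j == Ordinal jd) (negbTE jc) !mul0n.
Qed.

(** The terms with K * M dominate the others.  For two rows of generators composed
    with a positive matrix, P = Q forces c = c'. *)
Lemma generator_rows_inj K M c c' S P Q k : (0 < M)%N -> (0 < P)%N -> (0 < Q)%N ->
  (c < k)%N -> (c' < k)%N -> (P <= S)%N -> (Q <= S)%N -> (k * S < K)%N ->
  ((K * M + c) * P = (K * M + c') * Q)%N -> P = Q.
Proof.
move=> M0; wlog le : c c' P Q / (P <= Q)%N.
  move=> hw P0 Q0 ck c'k PS QS kS e.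
  case: (leqP P Q) => PQ; first exact: (hw c c' P Q).
  by apply/esym/(hw c' c Q P) => //; exact: ltnW.
move=> P0 Q0 ck c'k PS QS kS e; apply/eqP; rewrite eqn_leq le /= leqNgt; apply/negP => lt.
have h1 : (c * P <= k * S)%N by rewrite leq_mul // ltnW.
have h2 : (K <= K * M)%N by rewrite leq_pmulr.
have h3 : (K * M * P.+1 <= K * M * Q)%N by rewrite leq_mul2l lt orbT.
rewrite !mulnDl mulnS in e h3; lia.
Qed.

(** M, the number of letters and C are known before K.  The sum of the new heights
    is at most a constant E1 times the number of letters times K, so that for
    n >= K the cost is linear in n with a constant independent of K. *)
Lemma refine_exists i s : admissible s -> exists s', refines i s s' /\ admissible s'.
Proof.
case: s => m k C h t g [/= k2 C0]; have [M M0 MP] := generators_push m.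
pose k' := (d m).*2.
pose E1 := ((1 + M + k') * \sum_(b < k) (\sum_(j < d m) C j b) * h b)%N.
have [N NP] := p_superlinear (i.+1 * (k' + k' * E1))%N.
pose K := (N + t + k' * \sum_(j < d m) C j 0 + 1)%N.
have K0 : (0 < K)%N by rewrite /K addn1.
have [n [C' [n0 C'0 CP]]] := MP K K0.
pose mx c b := (\sum_(j < d m) generator K M c j * C j b)%N.
have row c b : (c < k')%N ->
    mx c b = (K * \sum_(j < d m) C j b + (K * M + c) * C c./2 b)%N.
  exact: (sum_generator_row K M (C^~ b)).
exists (Stage (n + m) k' C' (fun c => \sum_(b < k) mx c b * h b)%N K (generator K M)).
split; last by split=> //=; rewrite /k'; have := d_gt0 m; lia.
have C_le j b : (j < d m)%N -> (C j b <= \sum_(j < d m) C j b)%N.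
  by move=> jd; rewrite [leqRHS](bigD1 (Ordinal jd)) //= leq_addr.
split=> //=.
- by exists n.
- move=> c c' ck c'k /(_ 0%N (ltnW k2)); rewrite /stage_mx /= -/(mx c 0%N) -/(mx c' 0%N) !row //.
  have jc : (c./2 < d m)%N by move: ck; rewrite /k'; lia.
  have jc' : (c'./2 < d m)%N by move: c'k; rewrite /k'; lia.
  move=> /addnI e.
  have ePQ : C c./2 0%N = C c'./2 0%N.
    apply: (generator_rows_inj (S := (\sum_(j < d m) C j 0)%N) M0 _ _ ck c'k _ _ _ e);
      rewrite ?C0 ?C_le ?(ltnW k2) //.
    by rewrite /K addn1 ltnS leq_addl.
  move/eqP: e; rewrite ePQ eqn_pmul2r ?C0 ?(ltnW k2) // eqn_add2l => /eqP; exact.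
- move=> c b ck bk; rewrite /stage_mx /= -/(mx c b) row //.
  apply: leq_trans (leq_addr _ _); rewrite leq_pmulr // (bigD1 (Ordinal (d_gt0 m))) //=.
  by rewrite addn_gt0 C0.
- by rewrite /K; lia.
- move=> q Kq; apply: le_trans (NP q _); last by move: Kq; rewrite /K; lia.
  rewrite ler_nat -mulnA leq_mul2l mulnDl leq_add2l; apply/orP; right.
  apply: leq_trans (_ : k' * E1 * K <= _)%N; last by rewrite leq_mul2l Kq orbT.
  rewrite -mulnA -[in leqRHS](card_ord k') -sum_nat_const; apply: leq_sum => c _.
  rewrite /E1 mulnC mulnA big_distrr; apply: leq_sum => b _ /=.
  rewrite mulnA leq_mul2r; apply/orP; right; rewrite big_distrr; apply: leq_sum => j _ /=.
  rewrite leq_mul2r; apply/orP; right; rewrite /generator.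
  have ck : (c < k')%N := ltn_ord c.
  have h1 : ((j == c./2 :> nat) * (K * M + c) <= K * M + K * k')%N.
    case: eqP => _ //; rewrite mul1n leq_add2l (leq_trans (ltnW ck)) //.
    by rewrite leq_pmull.
  by rewrite !mulnDr muln1; lia.
Qed.

Lemma stages_exist s : admissible s -> exists st : nat -> stage, st 0%N = s /\
  forall i, admissible (st i) /\ refines i (st i) (st i.+1).
Proof.
move=> s0.
have /choice[next nextP] : forall si : stage * nat, exists s',
    admissible si.1 -> refines si.2 si.1 s' /\ admissible s'.
  move=> [s' i]; have [/(refine_exists i)[s'' s''P]|no] := pselect (admissible s').
    by exists s''.
  by exists s'.
pose st := fix st i := if i is j.+1 then next (st j, j) else s.
have adm i : admissible (st i).
  by elim: i => //= i IH; exact: (nextP (st i, i) IH).2.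
by exists st; split=> // i; split; [exact: adm|exact: (nextP (st i, i) (adm i)).1].
Qed.

Section StageLimit.
Variables (G : zmodType) (Gp : set G) (phi : nat -> (nat -> int) -> G).
Hypothesis phiP : presents d a Gp phi.
Variable st : nat -> stage.
Hypothesis stP : forall i, admissible (st i) /\ refines i (st i) (st i.+1).

Definition stage_psi (i : nat) (x : nat -> int) : G :=
  phi (level (st i)) (apply_mx (letters (st i)) (coord (st i)) x).

Lemma leq_level i : (i <= level (st i))%N.
Proof.
by elim: i => // i IH; have [_ [[n [n0 -> _]] _ _ _ _ _]] := stP i; lia.
Qed.

Lemma stage_psi_gens i y :
  stage_psi i.+1 (apply_mx (d (level (st i))) (gens (st i.+1)) y) = phi (level (st i)) y.
Proof.
have [_ [[n [n0 e yP]] _ _ _ _ _]] := stP i.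
rewrite -(psi_push phiP n) /stage_psi e; apply: presents_eq phiP _ _ _ _ => b bd.
by rewrite yP ?e.
Qed.

Lemma stage_mxE i x b :
  apply_mx (letters (st i)) (stage_mx (st i) (st i.+1)) x b =
  apply_mx (d (level (st i))) (gens (st i.+1))
    (apply_mx (letters (st i)) (coord (st i)) x) b.
Proof. by rewrite apply_mx_mul. Qed.

Lemma stage_onto g : exists i x, stage_psi i x = g /\
  (Gp g -> forall c, (c < letters (st i))%N -> 0 <= x c).
Proof.
have rep m y : exists i z, phi (level (st i)) z = phi m y /\
    ((forall b, (b < d m)%N -> 0 <= y b) -> forall b, 0 <= z b \/ (d (level (st i)) <= b)%N).
  exists m, (push d a (level (st m) - m) m y); split.
    by have := psi_push phiP (level (st m) - m) m y; rewrite subnK ?leq_level.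
  move=> y0 b; case: (ltnP b (d (level (st m)))) => bd; [left|by right].
  rewrite push_entry ?subnK ?leq_level //; apply: sumr_ge0 => j _.
  by rewrite mulrn_wge0 ?y0.
have nonneg i z : (forall b, 0 <= z b \/ (d (level (st i)) <= b)%N) ->
    forall c, 0 <= apply_mx (d (level (st i))) (gens (st i.+1)) z c.
  move=> z0 c; apply: sumr_ge0 => j _; rewrite mulrn_wge0 //.
  by have [//|] := z0 j; rewrite leqNgt ltn_ord.
have [Gg|nGg] := pselect (Gp g).
  have [m [y [y0 <-]]] := (presents_cone phiP g).1 Gg; have [i [z [e z0]]] := rep m y.
  exists i.+1, (apply_mx (d (level (st i))) (gens (st i.+1)) z).
  by split=> [|_ c _]; [rewrite stage_psi_gens|apply/nonneg/z0].
have [m [y eg]] := presents_surj phiP g; have [i [z [e _]]] := rep m y.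
exists i.+1, (apply_mx (d (level (st i))) (gens (st i.+1)) z).
by split=> [|Gg]; [rewrite stage_psi_gens e|case: (nGg Gg)].
Qed.

(** The new groups Z^letters and the original groups Z^(d (level s)) interlace, so
    they have the same limit. *)
Lemma stages_present :
  presents (fun i => letters (st i)) (fun i => stage_mx (st i) (st i.+1)) Gp stage_psi.
Proof.
split.
- move=> i x y xy; apply: presents_eq phiP _ _ _ _ => b _; exact: eq_apply_mx.
- move=> i x y; rewrite /stage_psi -(presents_sub phiP).
  apply: presents_eq phiP _ _ _ _ => b _; rewrite /apply_mx -sumrB.
  by apply: eq_bigr => c _; rewrite mulrnBl.
- move=> i x; rewrite -[RHS]stage_psi_gens; apply: presents_eq phiP _ _ _ _ => b _.
  by apply: eq_apply_mx => c _; exact: stage_mxE.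
- by move=> g; have [i [x [e _]]] := stage_onto g; exists i, x.
- move=> i x /(presents_ker phiP)[n nz].
  set k := fun i => letters (st i); set B := fun i => stage_mx (st i) (st i.+1).
  set y := apply_mx _ _ x in nz.
  have [N [nN eN eP]] : exists N, [/\ (n <= N)%N, level (st (n + i)) = (N + level (st i))%N &
      forall b, (b < d (level (st (n + i))))%N ->
        apply_mx (letters (st (n + i))) (coord (st (n + i))) (push k B n i x) b =
        push d a N (level (st i)) y b].
    elim: {nz} n => [|n [N [nN eN IH]]]; first by exists 0%N.
    have [_ [[q [q0 e yP]] _ _ _ _ _]] := stP (n + i).
    exists (q + N)%N; split; [lia|by rewrite addSn e eN addnA|move=> b bd].
    rewrite addSn in bd *; rewrite push_add -eN.
    have bd' : (b < d (q + level (st (n + i))))%N by rewrite -e.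
    rewrite -(push_eq a IH bd') -yP //; apply: eq_apply_mx => c _; exact: stage_mxE.
  exists n.+1 => b bd /=; rewrite [LHS]stage_mxE; apply: big1 => c _.
  rewrite eP // -(subnK nN) push_add push_eq0 ?mul0rn //.
  by rewrite addnA subnK // -eN.
- move=> g; split=> [Gg|[i [x [x0 <-]]]].
    by have [i [x [e x0]]] := stage_onto g; exists i, x; split=> //; exact: x0.
  apply/(presents_cone phiP); exists (level (st i)).
  exists (apply_mx (letters (st i)) (coord (st i)) x); split=> // b _.
  by apply: sumr_ge0 => c _; rewrite mulrn_wge0 ?x0.
Qed.

End StageLimit.

End Stages.

(** * Presenting simple dimension groups *)

Section SimpleDimensionGroups.
Local Open Scope ring_scope.
Local Open Scope classical_set_scope.

Section MatrixLimitPresentation.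
Variables (G : zmodType) (Gp : set G).
Variables (d : nat -> nat) (A : forall i, 'M[int]_(d i.+1, d i)).
Hypothesis A_gt0 : forall i j k, 0 < A i j k.
Variable phi : {additive G -> mx_lim A}.
Hypotheses (phi_bij : bijective phi) (phi_cone : phi @` Gp = mx_lim_cone A).

(** The matrices extended by 0 to functions on nat, which avoids the dependency of
    indices on dimensions. *)
Definition nat_entry (i b j : nat) : nat :=
  if (insub b, insub j) is (Some b', Some j') then `|A i b' j'|%N else 0%N.

Definition lim_class (i : nat) (x : nat -> int) : mx_lim A :=
  ind_lim_class (G := fun i => 'cV[int]_(d i) : zmodType) (mx_lim_step A)
    (\col_(j < d i) x j).

Lemma nat_entryE i (b : 'I_(d i.+1)) (j : 'I_(d i)) : (nat_entry i b j)%:Z = A i b j.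
Proof.
rewrite /nat_entry !valK /=.
by have := A_gt0 b j; lia.
Qed.

Lemma nat_entry_gt0 i b j : (b < d i.+1)%N -> (j < d i)%N -> (0 < nat_entry i b j)%N.
Proof.
move=> bi ji; have := @nat_entryE i (Ordinal bi) (Ordinal ji); have := A_gt0 (Ordinal bi) (Ordinal ji).
by rewrite /=; lia.
Qed.

Lemma mulmx_incidence i (x : nat -> int) :
  A i *m (\col_(j < d i) x j) = \col_(b < d i.+1) incidence d nat_entry i x b.
Proof.
apply/matrixP => b z; rewrite !mxE /incidence; apply: eq_bigr => j _.
by rewrite mxE -nat_entryE -mulr_natr natz mulrC.
Qed.

Lemma col_of_fun i (v : 'cV[int]_(d i)) : exists x : nat -> int, v = \col_(j < d i) x j.
Proof.
exists (fun j => if insub j is Some j' then v j' 0 else 0).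
by apply/matrixP => j z; rewrite mxE valK ord1.
Qed.

Lemma iter_lim_step n i (x : nat -> int) :
  iter n (ind_lim_step (mx_lim_step A))
    (Tagged (fun i => 'cV[int]_(d i) : zmodType) (\col_(j < d i) x j)) =
  Tagged (fun i => 'cV[int]_(d i) : zmodType) (\col_(j < d (n + i)) push d nat_entry n i x j).
Proof.
elim: n => //= n ->; rewrite /ind_lim_step /=; congr Tagged.
exact: mulmx_incidence.
Qed.

(** The class of a vector in the limit vanishes exactly when some push of the vector
    does, and the inverse of the given isomorphism transports all this to G. *)
Lemma mx_lim_presents : exists psi, presents d nat_entry Gp psi.
Proof.
have [g phiK gK] := phi_bij; exists (fun i x => g (lim_class i x)); split.
- by move=> i x y xy; congr (g (ind_lim_class _ _)); apply/matrixP => j z; rewrite !mxE xy.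
- move=> i x y; apply: (can_inj phiK); rewrite raddfB !gK /lim_class.
  have -> : \col_(j < d i) (x j - y j) = \col_(j < d i) x j + - (\col_(j < d i) y j).
    by apply/matrixP => j z; rewrite !mxE.
  rewrite -[RHS]/(ind_lim_add _ (ind_lim_opp _)) ind_lim_oppE.
  exact/esym/ind_lim_class_addE.
- move=> i x; congr g; rewrite /lim_class -mulmx_incidence.
  exact: (ind_lim_class_step (mx_lim_step A)).
- move=> q; have [i [v e]] := ind_lim_classP (phi q); have [x ex] := col_of_fun v.
  by exists i, x; apply: (can_inj phiK); rewrite gK e ex.
- move=> i x g0; have e : lim_class i x = lim_class i (fun=> 0).
    rewrite -[LHS]gK g0 raddf0 /lim_class.
    rewrite -[LHS]/(ind_lim_zero _) (ind_lim_zeroE (mx_lim_step A) i); congr ind_lim_class.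
    by apply/matrixP => j z; rewrite !mxE.
  move/eqmodP: e => /ind_lim_equivP[m [n]]; rewrite iter_lim_step (iter_lim_step n i (fun=> 0)) => e.
  have emn : m = n by apply: (@addIn i); exact: (congr1 (@tag _ _) e).
  subst n; exists m => b bd; move/eqP: e; rewrite eq_Tagged /= => /eqP.
  move=> /matrixP/(_ (Ordinal bd) 0); rewrite !mxE /= => ->; exact: push_eq0.
- move=> q; split=> [Gq|[i [x [x0 <-]]]].
    have : mx_lim_cone A (phi q) by rewrite -phi_cone; exists q.
    move=> [i [v [v0 e]]]; have [x ex] := col_of_fun v.
    exists i, x; split; last by apply: (can_inj phiK); rewrite gK e ex.
    by move=> j ji; have := v0 (Ordinal ji); rewrite ex mxE.
  have : mx_lim_cone A (lim_class i x).
    by exists i, (\col_(j < d i) x j); split=> // j; rewrite mxE x0.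
  by rewrite -phi_cone => -[q' Gq' <-]; rewrite phiK.
Qed.

End MatrixLimitPresentation.

Lemma simple_dimension_group_presents (G : zmodType) (Gp : set G) :
  is_simple_dimension_group Gp -> exists d a psi,
    [/\ forall i, (0 < d i)%N,
        forall i b j, (b < d i.+1)%N -> (j < d i)%N -> (0 < a i b j)%N &
        presents d a Gp psi].
Proof.
move=> [_ [d [A [d0 A0 [phi [phi_bij phi_cone]]]]]].
have [psi psiP] := mx_lim_presents A0 phi_bij phi_cone.
by exists d, (nat_entry A), psi; split=> // i b j; exact: nat_entry_gt0.
Qed.

End SimpleDimensionGroups.

Section CyclicGroups.
Local Open Scope ring_scope.
Variables (d : nat -> nat) (a : nat -> nat -> nat -> nat).
Variables (G : zmodType) (Gp : set G) (phi : nat -> (nat -> int) -> G).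
Hypothesis phiP : presents d a Gp phi.
Variable m1 : nat.
Hypothesis stationary : forall m, (m1 <= m)%N -> d m = 1%N /\ a m 0 0 = 1%N.

Lemma stationary_incidence m x : (m1 <= m)%N -> incidence d a m x 0 = x 0%N.
Proof. by move=> /stationary[d1 a1]; rewrite /incidence d1 big_ord1 a1. Qed.

Lemma phi_stationary n x : phi (n + m1) x = phi m1 x.
Proof.
elim: n => // n <-; rewrite -(presents_step phiP (n + m1)); apply: presents_eq phiP _ _ _ _ => b.
have [|-> _] := @stationary (n.+1 + m1); first by rewrite leq_addl.
by rewrite ltnS leqn0 => /eqP ->; rewrite stationary_incidence // leq_addl.
Qed.

(** From level m1 on the connecting maps are the identity of Z, so that the single
    map [phi m1] describes the whole limit. *)
Lemma phi_to_stationary i x : phi i x = phi m1 (push d a m1 i x).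
Proof. by rewrite -(psi_push phiP m1) addnC phi_stationary. Qed.

Lemma stationary_presents : presents (fun=> 1%N) (fun _ _ _ => 1%N) Gp (fun=> phi m1).
Proof.
have [d1 _] := stationary (leqnn m1).
split=> [i x y xy|i x y|i x|g|i x x0|g].
- by rewrite /=; apply: presents_eq phiP _ _ _ _; rewrite d1.
- exact: presents_sub phiP _ _ _.
- by rewrite /=; apply: presents_eq phiP _ _ _ _ => b; rewrite d1 /incidence big_ord1 => /ltnSE; case: b.
- by have [i [x <-]] := presents_surj phiP g; exists 0%N, (push d a m1 i x); rewrite -phi_to_stationary.
- exists 0%N => -[_ /=|//]; have {i} [n /(_ 0%N)] := presents_ker phiP x0.
  have [|-> _] := @stationary (n + m1); first by rewrite leq_addl.
  move=> /(_ isT) <-; elim: n => //= n {1}->.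
  by rewrite stationary_incidence // leq_addl.
- split=> [/(presents_cone phiP)[i [x [x0 <-]]]|[_ [x [x0 <-]]]].
    exists 0%N, (push d a m1 i x); split; last exact/esym/phi_to_stationary.
    move=> b b1; rewrite push_entry; last first.
      by have [|-> _] := @stationary (m1 + i); first by rewrite leq_addr.
    by apply: sumr_ge0 => j _; rewrite mulrn_wge0 ?x0.
  by apply/(presents_cone phiP); exists m1, x; rewrite d1.
Qed.

End CyclicGroups.

Section Ratios.
Local Open Scope ring_scope.
Local Open Scope classical_set_scope.
Variables (R : realType) (p : nat -> R).
Hypothesis p_gt0 : forall n, 0 < p n.

Lemma superlinear_of_cvg : (fun n : nat => n%:R / p n) @ \oo --> (0 : R) ->
  forall E : nat, exists N, forall n, (N <= n)%N -> (E * n)%:R <= p n.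
Proof.
move=> hp E; have E0 : 0 < (E.+1%:R : R)^-1 by rewrite invr_gt0.
have [N _ NP] := (@cvgr0Pnorm_lt _ _ _ _ _ _).1 hp _ E0; exists N => n Nn.
have := le_lt_trans (ler_norm _) (NP n Nn).
rewrite ltr_pdivrMr // mulrC ltr_pdivlMr ?ltr0n // -natrM => lt.
by apply: le_trans (ltW lt); rewrite ler_nat; lia.
Qed.

Lemma cvg_of_superlinear (c : nat -> nat) :
  (forall E : nat, exists N, forall n, (N <= n)%N -> (E * c n)%:R <= p n) ->
  (fun n : nat => (c n)%:R / p n) @ \oo --> (0 : R).
Proof.
move=> cP; apply/cvgr0Pnorm_lt => e e0.
have [E Ee] : exists E : nat, e^-1 < E%:R.
  by exists (Num.trunc e^-1).+1; exact: truncnS_gt.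
have [N NP] := cP E; exists N => // n /= /NP le.
rewrite ger0_norm; last by rewrite divr_ge0 // ltW.
rewrite ltr_pdivrMr //.
have Ep : (0 : R) < E%:R by apply: lt_trans Ee; rewrite invr_gt0.
case: (posnP (c n)) => [->|c0]; first by rewrite mulr_gt0.
apply: lt_le_trans (ler_wpM2l (ltW e0) le).
rewrite natrM mulrA ltr_pMl ?ltr0n //.
by rewrite -ltr_pdivrMl // mulr1.
Qed.

End Ratios.

(** * Realization *)

Section Realization.
Local Open Scope ring_scope.
Local Open Scope classical_set_scope.
Variables (R : realType) (p : nat -> R).
Hypothesis p_gt0 : forall n, 0 < p n.
Hypothesis p_superlinear : forall E : nat, exists N, forall n, (N <= n)%N -> (E * n)%:R <= p n.
Variables (G : zmodType) (Gp : set G) (u : G).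

Definition realized : Prop := exists (A : finType) (Y : subshift A),
  [/\ (0 < #|A|)%N, minimal_subshift Y,
      unital_ordered_group_iso (K0_cone (subshift_map Y)) Gp (K0_unit (subshift_map Y)) u &
      (fun n : nat => (complexity Y n)%:R / p n) @ \oo --> (0 : R)].

Variables (d : nat -> nat) (a : nat -> nat -> nat -> nat) (phi : nat -> (nat -> int) -> G).
Hypothesis d_gt0 : forall i, (0 < d i)%N.
Hypothesis a_gt0 : forall i b j, (b < d i.+1)%N -> (j < d i)%N -> (0 < a i b j)%N.
Hypothesis phiP : presents d a Gp phi.
Hypothesis u_unit : is_order_unit Gp u.

(** One tower at each level, each being a single copy of the preceding one: the
    subshift is a periodic orbit, of bounded complexity. *)
Lemma realize_cyclic (m1 : nat) :
  (forall m, (m1 <= m)%N -> d m = 1%N /\ a m 0 0 = 1%N) -> realized.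
Proof.
move=> stat; have [i [x [x0 xu]]] := order_unit_gt0 phiP d_gt0 a_gt0 u_unit.
have [d1 _] := stat _ (leqnn m1).
have y0 : 0 < push d a m1 i x 0 by apply: push_gt0.
pose h (b : nat) : nat := `|push d a m1 i x b|%N.
have h_gt0 b : (b < 1)%N -> (0 < h b)%N by rewrite ltnS leqn0 => /eqP ->; rewrite /h; lia.
pose k (i : nat) : nat := 1%N; pose B (i b j : nat) : nat := 1%N.
have k_gt0 i' : (0 < k i')%N by [].
have B_gt0 i' b j : (b < k i'.+1)%N -> (j < k i')%N -> (0 < B i' b j)%N by [].
have recP : recognizable_towers k B h by exact: cyclic_recognizable.
have propP : proper_towers k B h by exact: cyclic_proper.
exists (tower_alphabet k h), (tower_subshift k_gt0 B_gt0 h_gt0 recP).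
split.
- by rewrite card_prod !card_ord.
- exact: tower_subshift_minimal propP.
- apply: (tower_subshift_K0 k_gt0 B_gt0 h_gt0 recP propP (stationary_presents phiP stat)).
  rewrite -xu (phi_to_stationary phiP stat i) /=; apply: presents_eq phiP _ _ _ _ => b.
  by rewrite d1 ltnS leqn0 => /eqP ->; rewrite /h; lia.
- apply: cvg_of_superlinear => // E; have [N NP] := p_superlinear (E * h 0)%N.
  exists (maxn N 1) => n; rewrite geq_max => /andP[Nn n1]; apply: le_trans (NP n Nn).
  rewrite ler_nat -mulnA leq_mul2l; apply/orP; right.
  apply: leq_trans (tower_complexity_cyclic k_gt0 B_gt0 h_gt0 recP n erefl) _.
  by rewrite leq_pmulr.
Qed.

(** A length n between two consecutive thresholds is below all entries of the
    matrix of the second one, and beyond the threshold where the cost of the first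
    one is controlled. *)
Lemma realize_expanding : expanding d a -> realized.
Proof.
move=> expand; have [i0 [x [x0 xu]]] := order_unit_gt0 phiP d_gt0 a_gt0 u_unit.
have [M M0 MP] := generators_push d_gt0 a_gt0 expand i0.
(* the initial stage: heights are the values at x of the generators, K = 1 *)
have [q [C [q0 C0 CP]]] := MP 1%N isT.
pose r c := (\sum_(j < d i0) generator 1 M c j * `|x j|)%N.
pose s0 := Stage (q + i0) (d i0).*2 C r 0 (generator 1 M).
have s0_adm : admissible d s0 by split=> //=; have := d_gt0 i0; lia.
have [st [st0 stP]] := stages_exist d_gt0 a_gt0 expand p_superlinear s0_adm.
pose k i := letters (st i); pose B i := stage_mx d (st i) (st i.+1).
have k_gt1 i : (1 < k i)%N by have [[]] := stP i.
have k_gt0 i : (0 < k i)%N by apply: ltnW.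
have t_gt i : (i <= threshold (st i))%N.
  by elim: i => // i IH; have [_ []] := stP i; lia.
have B_ge i b c : (b < k i.+1)%N -> (c < k i)%N -> (threshold (st i.+1) <= B i b c)%N.
  by have [_ [_ _ _ + _ _]] := stP i; apply.
have B_gt0 i b c : (b < k i.+1)%N -> (c < k i)%N -> (0 < B i b c)%N.
  by move=> bi ci; apply: leq_trans (B_ge i b c bi ci); have := t_gt i.+1; lia.
have B_inj i b b' : (b < k i.+1)%N -> (b' < k i.+1)%N ->
    (forall c, (c < k i)%N -> B i b c = B i b' c) -> b = b'.
  by have [_ [_ _ + _ _ _]] := stP i; apply.
have r_gt0 c : (c < k 0)%N -> (0 < r c)%N.
  move=> _; rewrite /r (bigD1 (Ordinal (d_gt0 i0))) //= addn_gt0 muln_gt0 /generator.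
  by have := x0 0%N (d_gt0 i0); lia.
have hE i c : height k B r i c = heights (st i) c.
  elim: i c => [|i IH] c; first by rewrite st0.
  have [_ [_ -> _ _ _ _]] := stP i; rewrite -offset_height /offset.
  by apply: eq_bigr => b _; rewrite IH.
have recP : recognizable_towers k B r by exact: substitution_recognizable.
have propP : proper_towers k B r.
  apply: large_entries_proper => // N; exists N => b c bi ci.
  by apply: leq_trans (B_ge _ _ _ bi ci); exact: t_gt.
exists (tower_alphabet k r), (tower_subshift k_gt0 B_gt0 r_gt0 recP).
split.
- by rewrite card_prod !card_ord.
- exact: tower_subshift_minimal propP.
- apply: (tower_subshift_K0 k_gt0 B_gt0 r_gt0 recP propP (stages_present phiP stP)).
  rewrite /stage_psi st0 /= -xu -(psi_push phiP q i0 x); apply: presents_eq phiP _ _ _ _ => b bd.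
  rewrite -CP //; apply: eq_apply_mx => c _.
  rewrite [LHS](esym (apply_mx_nat (d i0) (generator 1 M) (fun j => `|x j|%N) c)).
  apply: eq_bigr => j _.
  by have := x0 j (ltn_ord j); move=> xj; congr (_ *+ _); lia.
- apply: cvg_of_superlinear => // E; exists (threshold (st E.+1)) => n En.
  (* the last stage whose threshold is at most n *)
  pose P i := (threshold (st i.+1) <= n)%N && (E <= i)%N.
  have exP : exists i, P i by exists E; rewrite /P En leqnn.
  have Pb i : P i -> (i <= n)%N by move=> /andP[le _]; have := t_gt i.+1; lia.
  have [i /andP[ti Ei] imax] := ex_maxnP exP Pb.
  have lt : (n < threshold (st i.+2))%N.
    rewrite ltnNge; apply/negP => le; have := imax i.+1; rewrite /P le /=.
    by move=> /(_ (leqW Ei)); rewrite ltnn.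
  have [_ [_ _ _ _ _ /(_ n ti)]] := stP i; apply: le_trans.
  rewrite ler_nat leq_mul //; first exact: leqW.
  apply: leq_trans (tower_complexity (i := i.+1) (n := n) k_gt0 B_gt0 r_gt0 recP _) _.
    by move=> b c bi ci; apply: leq_trans (ltnW lt) (B_ge _ _ _ bi ci).
  by rewrite leq_add2l; apply: leq_sum => c _; rewrite hE.
Qed.

End Realization.

Local Open Scope classical_set_scope.
Local Open Scope ring_scope.

Theorem theorem1p1 (R : realType) (G : zmodType) (Gp : set G) (u : G)
    (hG : is_simple_dimension_group_with_unit Gp u)
    (p : nat -> R) (p_gt0 : forall n, 0 < p n)
    (hp : (fun n : nat => n%:R / p n) @ \oo --> (0 : R)) :
  exists (A : finType) (Y : subshift A),
    [/\ (0 < #|A|)%N,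
        minimal_subshift Y,
        unital_ordered_group_iso
          (K0_cone (subshift_map Y)) Gp (K0_unit (subshift_map Y)) u &
        (fun n : nat => (complexity Y n)%:R / p n) @ \oo --> (0 : R)].
Proof.
have [simpleG u_unit] := hG.
have [d [a [phi [d_gt0 a_gt0 phiP]]]] := simple_dimension_group_presents simpleG.
have p_superlinear := superlinear_of_cvg p_gt0 hp.
have [expand|[m1 stat]] := expanding_or_cyclic d_gt0 a_gt0.
  exact: (realize_expanding p_gt0 p_superlinear d_gt0 a_gt0 phiP u_unit expand).
exact: (realize_cyclic p_gt0 p_superlinear d_gt0 a_gt0 phiP u_unit stat).
Qed.
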